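(* (1) For an ordinary semicascade $(\Omega,\varphi)$, the sequence of Cesàro means $V_n=\frac1n(I+V+\dots+V^{n-1})$ always contains a subsequence $V_{n(k)}$ that converges in the $\mathrm{W}^*\mathrm{O}$-topology. (2) If for a tame semicascade $(\Omega,\varphi)$ the proximality relation $\mathrm{P}(\Omega,\varphi)$ is transitive, then the operator means $V_n$ converge in the $\mathrm{W}^*\mathrm{O}$-topology as $n\to\infty$.
   Context: $\Omega$ is a metrizable compact space and $\varphi:\Omega\to\Omega$ is a continuous (not necessarily invertible) map; $(\Omega,\varphi)$ is the corresponding semicascade. $X=C(\Omega)$ is the Banach space of continuous scalar functions, $X^*$ its dual (Borel measures on $\Omega$), with pairing $(x,\mu)=\int_\Omega x\,d\mu$. $U\in\mathrm{End}\,X$ is $(Ux)(\omega)=x(\varphi\omega)$, $V=U^*\in\mathrm{End}\,X^*$, $I$ is the identity; $\mathrm{End}$ denotes bounded linear operators. The $\mathrm{W}^*\mathrm{O}$-topology on $\mathrm{End}\,X^*$: $T_\alpha\to T$ iff $(x,T_\alpha y)\to(x,Ty)$ for all $x\in X$, $y\in X^*$. The enveloping semigroup $E(\Omega,\varphi)$ is the closure of $\{\varphi^n:n\ge 0\}$ in $\Omega^\Omega$ with the topology of pointwise convergence; $(\Omega,\varphi)$ is ordinary if $E(\Omega,\varphi)$ is metrizable. The semicascade is tame if, for each $x\in C(\Omega)$ and each increasing sequence $\{n(k)\}$ of positive integers, $\inf_a\|\sum_{k\ge 1}a_kx_{n(k)}\|_{C(\Omega)}=0$, where $x_n(\omega)=x(\varphi^n\omega)$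 and the infimum is over finite (finitely supported) real sequences $a=\{a_k\}$ with $\sum_k|a_k|=1$. Points $\omega_1,\omega_2\in\Omega$ are proximal, written $(\omega_1,\omega_2)\in\mathrm{P}(\Omega,\varphi)$, if $\inf_{n\ge0}\rho(\varphi^n\omega_1,\varphi^n\omega_2)=0$, where $\rho$ is a fixed metric compatible with the topology of $\Omega$. Transitivity means that $\mathrm{P}(\Omega,\varphi)$ is an equivalence relation. *)

(* Defs.v *)
From HB Require Import structures.
From Corelib Require Import RelationClasses.
From mathcomp Require Import all_boot all_order all_algebra.
From mathcomp Require Import all_classical all_reals all_analysis.
From mathcomp Require Import lra complex.

Set Implicit Arguments.
Unset Strict Implicit.
Unset Printing Implicit Defensive.

Import Order.TTheory GRing.Theory Num.Theory.
Import numFieldNormedType.Exports.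

Local Open Scope classical_set_scope.
Local Open Scope ring_scope.

(* "Scalar" functions may be real- or complex-valued: the definitions below
   are uniform in the choice [s] of one of the two scalar fields. *)
Variant scalar_kind := RealScalars | ComplexScalars.

Definition scalar_field (R : realType) (s : scalar_kind) : numFieldType :=
  match s with RealScalars => R | ComplexScalars => R[i] end.

Definition of_real (R : realType) (s : scalar_kind) : R -> scalar_field R s :=
  match s with
  | RealScalars => fun r => r
  | ComplexScalars => fun r => r%:C%C
  end.

(* The modulus, with values in [R]: the library's norm on [R[i]] takes values
   in [R[i]]. *)
Definition modulus (R : realType) (s : scalar_kind) : scalar_field R s -> R :=
  match s with
  | RealScalars => fun z => `|z|
  | ComplexScalars => fun z => ComplexField.Normc.normc z
  end.

Section ModulusTheory.
Variables (R : realType) (s : scalar_kind).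
Local Notation mod := (@modulus R s).

Lemma modulus0 : mod 0 = 0.
Proof. by case: s => /=; [exact: normr0 | exact: ComplexField.Normc.normc0]. Qed.

Lemma modulusE z : of_real s (mod z) = `|z|.
Proof. by case: s z. Qed.

Lemma modulus_ge0 z : 0 <= mod z.
Proof.
by case: s z => [z|[a b]] /=; [exact: normr_ge0 | exact: sqrtr_ge0].
Qed.

Lemma modulusD z1 z2 : mod (z1 + z2) <= mod z1 + mod z2.
Proof.
case: s z1 z2 => z1 z2 /=; first exact: ler_normD.
by have := ler_normD z1 z2; rewrite /Num.norm /= -rmorphD lecR.
Qed.

Lemma modulusM z1 z2 : mod (z1 * z2) = mod z1 * mod z2.
Proof.
by case: s z1 z2 => z1 z2 /=; [exact: normrM | exact: ComplexField.Normc.normcM].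
Qed.

Lemma modulus_le z1 z2 : (mod z1 <= mod z2) = (`|z1| <= `|z2|).
Proof. by rewrite -!modulusE; case: s z1 z2 => z1 z2 //=; rewrite lecR. Qed.

Lemma continuous_modulus : continuous mod.
Proof.
move=> z; apply/(@cvgrPdist_lt _ _ _ (nbhs z)) => e e0.
have e0' : 0 < of_real s e by case: (s) => //=; rewrite ltcR.
have dist_mod z' : `|mod z - mod z'| <= mod (z - z').
  have := modulusD (z - z') z'; rewrite subrK => h1.
  have := modulusD (z' - z) z; rewrite subrK => h2.
  have e12 : mod (z' - z) = mod (z - z').
    by apply/eqP; rewrite eq_le !modulus_le distrC lexx.
  by rewrite ler_norml; apply/andP; split; lra.
have : \forall z' \near z, `|z - z'| < of_real s e.
  exact: (nbhsx_ballx z _ e0').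
apply: filterS => z'; rewrite -modulusE => h.
apply: le_lt_trans (dist_mod z') _.
by move: h; case: (s) z z' {dist_mod e0'} => z z' //=; rewrite ltcR.
Qed.

End ModulusTheory.

(* C(Omega), with the library's bundled continuous functions as carrier,
   as a submodule of the module of all functions. *)
Section ContinuousFunctions.
Variables (R : realType) (Omega : metricType R) (s : scalar_kind).
Local Notation K := (scalar_field R s).

Definition cts_pred : {pred Omega -> K} := mem [set x : Omega -> K | continuous x].

Definition cts_Sub (x : Omega -> K) (xP : x \in cts_pred) :
  continuousType Omega K := mkcts (set_mem xP).

Let cts_rect (P : continuousType Omega K -> Type) :
  (forall x (xP : x \in cts_pred), P (cts_Sub xP)) -> forall x, P x.
Proof.
move=> PS x.
have xP : (x : Omega -> K) \in cts_pred by apply/mem_set; exact: cts_fun.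
have -> : x = cts_Sub xP by apply/continuousEP.
exact: PS.
Qed.

Let cts_valP (x : Omega -> K) (xP : x \in cts_pred) :
  (cts_Sub xP : Omega -> K) = x.
Proof. by []. Qed.

HB.instance Definition _ := isSub.Build _ _ (continuousType Omega K)
  cts_rect cts_valP.

Lemma cts_submod_closed : submod_closed cts_pred.
Proof.
split; first by apply/mem_set => w; exact: cvg_cst.
move=> a x y /set_mem cx /set_mem cy; apply/mem_set => w.
by apply: cvgD; [apply: cvgZr; exact: cx | exact: cy].
Qed.

HB.instance Definition _ :=
  GRing.isSubmodClosed.Build K (Omega -> K) cts_pred cts_submod_closed.
HB.instance Definition _ :=
  [SubChoice_isSubLmodule of continuousType Omega K by <:].

Definition sup_norm (x : continuousType Omega K) : R :=
  sup [set modulus (x w) | w in [set: Omega]].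

Lemma sup_norm_ub (x : continuousType Omega K) (w : Omega) :
  compact [set: Omega] -> modulus (x w) <= sup_norm x.
Proof.
move=> cO; apply: ub_le_sup; last by exists w.
have /compact_bounded[M [Mreal bM]] :
    compact ((fun w => modulus (x w)) @` [set: Omega]).
  apply: continuous_compact => //; apply: continuous_subspaceT => z.
  exact: (continuous_comp (cts_fun z) (@continuous_modulus R s _)).
exists (M + 1) => r Ar; apply: le_trans (ler_norm r) _.
by apply: bM => //; rewrite ltrDl.
Qed.

Lemma sup_norm_ge0 (x : continuousType Omega K) : 0 <= sup_norm x.
Proof.
rewrite /sup_norm; have [hs|/sup_out ->] :=
  pselect (has_sup [set modulus (x w) | w in [set: Omega]]); last by [].
case: hs => -[_ [w _ _]] ub.
by apply: le_trans (modulus_ge0 (x w)) _; apply: ub_le_sup => //; exists w.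
Qed.

Lemma sup_norm_le (x : continuousType Omega K) (c : R) : 0 <= c ->
  (forall w, modulus (x w) <= c) -> sup_norm x <= c.
Proof.
move=> c0 xc; rewrite /sup_norm.
have [->|A0] := eqVneq [set modulus (x w) | w in [set: Omega]] set0.
  by rewrite sup0.
by apply: ge_sup; [exact/set0P | move=> _ [w _ <-]].
Qed.

(* The operator U. *)
Definition koopman (phi : continuousType Omega Omega)
  (x : continuousType Omega K) : continuousType Omega K := x \o phi.

Lemma koopmanE phi x w : koopman phi x w = x (phi w).
Proof. by []. Qed.

Lemma iter_koopmanE phi n x w :
  iter n (koopman phi) x w = x (iter n phi w).
Proof. by elim: n x w => // n IH x w; rewrite iterS koopmanE IH iterSr. Qed.

Lemma koopman_is_linear phi : linear (koopman phi).
Proof. by move=> a x y; apply/continuousEP. Qed.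

Lemma sup_norm_koopman phi x : compact [set: Omega] ->
  sup_norm (koopman phi x) <= sup_norm x.
Proof.
move=> cO; apply: sup_norm_le; first exact: sup_norm_ge0.
by move=> w; rewrite koopmanE; exact: sup_norm_ub.
Qed.

End ContinuousFunctions.

(* The dual X^* of X = C(Omega): the bounded linear functionals on X.  By the
   Riesz representation theorem these are the maps x |-> \int x dmu, with mu a
   (real or complex) Borel measure on Omega, so that evaluation [y x] is the
   pairing (x, y). *)
Section Dual.
Variables (R : realType) (Omega : metricType R) (s : scalar_kind).
Local Notation K := (scalar_field R s).
Local Notation X := (continuousType Omega K).

Definition bounded_functional (y : X -> K) :=
  exists M : R, forall x, modulus (y x) <= M * sup_norm x.

Definition dual_pred : {pred X -> K} :=
  mem [set y : X -> K | linear_for *%R y /\ bounded_functional y].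

Record dual := Dual { dual_fun :> X -> K ; _ : dual_fun \in dual_pred }.

HB.instance Definition _ := [isSub for dual_fun].
HB.instance Definition _ := [Choice of dual by <:].

Lemma dual_submod_closed : submod_closed dual_pred.
Proof.
split.
  apply/mem_set; split; first by move=> a u v; rewrite mulr0 addr0.
  by exists 0 => x; rewrite modulus0 mul0r.
move=> a y z /set_mem[yl [M yM]] /set_mem[zl [N zN]]; apply/mem_set; split.
  move=> b u v.
  have -> w : (a *: y + z) w = a * y w + z w by [].
  have -> w : (a *: y + z) w = a * y w + z w by [].
  by rewrite yl zl !mulrDr !mulrA [b * a]mulrC addrACA.
exists (modulus a * M + N) => x.
have -> : (a *: y + z) x = a * y x + z x by [].
rewrite (le_trans (modulusD _ _))// mulrDl lerD// modulusM -mulrA.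
by rewrite ler_wpM2l// modulus_ge0.
Qed.

HB.instance Definition _ :=
  GRing.isSubmodClosed.Build K (X -> K) dual_pred dual_submod_closed.
HB.instance Definition _ := [SubChoice_isSubLmodule of dual by <:].

Definition pairing (x : X) (y : dual) : K := y x.

Definition dual_norm (y : dual) : R :=
  sup [set modulus (pairing x y) | x in [set x : X | sup_norm x <= 1]].

(* End X^* : the bounded linear operators on X^*. *)
Definition bounded_operator (T : {linear dual -> dual}) :=
  exists M : R, forall y, dual_norm (T y) <= M * dual_norm y.

(* Convergence of a sequence of operators on X^* in the W^*O-topology. *)
Definition WstarO_cvg (Tn : nat -> dual -> dual) (T : dual -> dual) :=
  forall (x : X) (y : dual),
    (fun n => pairing x (Tn n y)) @ \oo --> pairing x (T y).

(* The limit is required to belong to End X^*. *)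
Definition WstarO_convergent (Tn : nat -> dual -> dual) :=
  exists2 T : {linear dual -> dual}, bounded_operator T & WstarO_cvg Tn T.

Variable cO : compact [set: Omega].

Lemma koopman_adj_subproof (phi : continuousType Omega Omega) (y : dual) :
  y \o koopman phi \in dual_pred.
Proof.
have /set_mem[yl [M yM]] : (y : X -> K) \in dual_pred by exact: valP.
apply/mem_set; split; first by move=> a u v /=; rewrite koopman_is_linear yl.
exists `|M| => x; rewrite (le_trans (yM _))//.
rewrite (le_trans (ler_wpM2r (sup_norm_ge0 _) (ler_norm M)))//.
by rewrite ler_wpM2l//; exact: sup_norm_koopman.
Qed.

(* The adjoint operator V = U^*. *)
Definition koopman_adj (phi : continuousType Omega Omega) (y : dual) : dual :=
  Dual (koopman_adj_subproof phi y).

(* V_n for n > 0. *)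
Definition cesaro_mean (phi : continuousType Omega Omega) (n : nat)
  (y : dual) : dual :=
  n%:R^-1 *: \sum_(i < n) iter i (koopman_adj phi) y.

End Dual.

Definition metrizable (R : realType) (T : topologicalType) :=
  exists d : T -> T -> R,
    [/\ forall p q, 0 <= d p q /\ (d p q = 0 <-> p = q),
        forall p q, d p q = d q p,
        forall p q r, d p r <= d p q + d q r &
        forall (p : T) (A : set T), nbhs p A <->
          exists2 e : R, 0 < e & [set q | d p q < e] `<=` A].

Section Semicascade.
Variables (R : realType) (Omega : metricType R).
Variable phi : continuousType Omega Omega.

(* {ptws Omega -> Omega} is Omega^Omega with the product topology. *)
Definition enveloping_semigroup : set {ptws Omega -> Omega} :=
  closure [set p : {ptws Omega -> Omega} | exists n : nat, p = iter n phi].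

(* A set coerced to a type carries the subspace topology. *)
Definition ordinary := metrizable R (set_type enveloping_semigroup).

Definition tame (s : scalar_kind) :=
  forall (x : continuousType Omega (scalar_field R s)) (n : nat -> nat),
    increasing_seq n -> (forall k, (0 < n k)%N) ->
    inf [set r : R | exists (N : nat) (a : 'I_N -> R),
           \sum_(k < N) `|a k| = 1 /\
           r = sup_norm (\sum_(k < N)
                 of_real s (a k) *: iter (n k) (koopman phi) x)] = 0.

Definition proximal (w1 w2 : Omega) : Prop :=
  inf [set mdist (iter n phi w1) (iter n phi w2) | n in [set: nat]] = 0.

End Semicascade.

(* Main.v *)
Require Import Defs.
From HB Require Import structures.
From Corelib Require Import RelationClasses.
From mathcomp Require Import all_boot all_order all_algebra.
From mathcomp Require Import all_classical all_reals all_analysis.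
From mathcomp Require Import ring lra zify complex.

(** By Luxemburg's form of Arzela's theorem, a bounded
    functional on C(Omega) sends bounded pointwise null sequences to null
    sequences, so W*O-convergence of V_{n(k)} follows from convergence of the
    Cesaro means of x(phi^i w) along n(k), for every real x and every point w.

    (1) A metric on the enveloping semigroup E makes p |-> x(p w) uniformly
    continuous, so the Cesaro means are controlled by the densities of the
    countably many classes of {phi^i} cut out by finite nets of E; n(k) is chosen
    so that all these densities converge.

    (2) Tameness forbids (a,b)-independent sequences, not only among the
    x o phi^i but also among their block means: the fair-coin functional of an
    independent sequence of block means correlates with some x o phi^(i_k), and
    testing against Riesz products shows that a subsequence of these spans l1.
    Hence (i) on a minimal set the limit f of the means along an ultrafilter is
    constant: f is invariant, and if it took two values, each would be taken on a
    dense set, and an independent sequence could be grown along a binary tree of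
    open sets;
    (ii) dominated convergence holds for ultrafilter limits of block means.
    If proximality is transitive, the Auslander-Ellis theorem shows that all
    minimal sets in the orbit closure Y of w intersect, so block means of x
    converge along an ultrafilter to one constant c on Y, and by (ii) every
    limit functional of the Cesaro means at w takes the value c at x. *)

Set Implicit Arguments.
Unset Strict Implicit.
Unset Printing Implicit Defensive.

Import Order.TTheory GRing.Theory Num.Theory.
Import numFieldNormedType.Exports.

Local Open Scope classical_set_scope.
Local Open Scope ring_scope.

(** * Finitely additive positive functionals *)

Section Bounded.
Context {R : realType} {T : Type}.
Implicit Types f g : T -> R.

Definition bnd f := exists C : R, forall t, `|f t| <= C.

Lemma bnd_pos f : bnd f -> exists2 C : R, 0 < C & forall t, `|f t| <= C.
Proof.
case=> C fC; exists (`|C| + 1); first by rewrite ltr_wpDl.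
by move=> t; rewrite (le_trans (fC t))// (le_trans (ler_norm C))// lerDl.
Qed.

Lemma bnd_cst c : bnd (fun=> c).
Proof. by exists `|c|. Qed.

Lemma bndD f g : bnd f -> bnd g -> bnd (fun t => f t + g t).
Proof.
move=> [C fC] [D gD]; exists (C + D) => t.
by rewrite (le_trans (ler_normD _ _))// lerD.
Qed.

Lemma bndM f g : bnd f -> bnd g -> bnd (fun t => f t * g t).
Proof.
move=> [C fC] [D gD]; exists (C * D) => t.
by rewrite normrM ler_pM.
Qed.

Lemma bndN f : bnd f -> bnd (fun t => - f t).
Proof. by move=> [C fC]; exists C => t; rewrite normrN. Qed.

Lemma bnd_norm f : bnd f -> bnd (fun t => `|f t|).
Proof. by move=> [C fC]; exists C => t; rewrite normr_id. Qed.

Lemma bnd_sum (N : nat) (F : nat -> T -> R) :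
  (forall i, bnd (F i)) -> bnd (fun t => \sum_(i < N) F i t).
Proof.
move=> bF; elim: N => [|N IH].
  by under eq_fun do rewrite big_ord0; exact: bnd_cst.
by under eq_fun do rewrite big_ord_recr; exact: bndD.
Qed.

End Bounded.

#[global] Hint Resolve bnd_cst bndD bndM bndN bnd_norm : bnd.
Ltac bnd := by auto 10 with bnd.

(** * Limits of bounded families along an ultrafilter *)

Section UltraLimits.
Context {R : realType} {J : Type} (U : set_system J) {UU : UltraFilter U}.

(** The image of [U] under [h] is an ultrafilter containing a compact interval, so it converges. *)
Lemma ulim_cvg (h : J -> R) : bnd h -> h @ U --> lim (h @ U).
Proof.
move=> [C hC].
have : compact `[- C, C]%classic by exact: segment_compact.
have hT : h @` setT `<=` `[- C, C]%classic.
  by move=> _ [j _ <-] /=; rewrite in_itv/= -ler_norml.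
rewrite compact_ultra => /(_ (h @ U)).
have UhU : UltraFilter (h @ U).
  split; first exact: fmap_proper_filter.
  move=> G PG hG; apply/seteqP; split => // A GA.
  have [//|UnA] := in_ultra_setVsetC (h @^-1` A) UU.
  have : G (~` A) by exact: hG.
  by move=> /(filterI GA); rewrite setICr => /filter_not_empty.
move=> /(_ UhU).
case; last by move=> l [_ hl]; apply/cvg_ex; exists l.
by rewrite /nbhs/=; apply: filterS (@filterT _ U _) => j _; apply: hT; exists j.
Qed.

Lemma ulimP (h : J -> R) l : h @ U --> l -> lim (h @ U) = l.
Proof. by move/cvg_lim; apply. Qed.

Lemma ulim_lin (a : R) (f g : J -> R) : bnd f -> bnd g ->
  lim ((fun j => a * f j + g j) @ U) = a * lim (f @ U) + lim (g @ U).
Proof.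
move=> bf bg; apply: ulimP; apply: cvgD; last exact: ulim_cvg.
by apply: cvgMr; exact: ulim_cvg.
Qed.

Lemma ulim_ge (c : R) (f : J -> R) : bnd f ->
  (\forall j \near U, c <= f j) -> c <= lim (f @ U).
Proof. by move=> bf cf; apply: limr_ge => //; exact: ulim_cvg. Qed.

Lemma ulim_le (c : R) (f : J -> R) : bnd f ->
  (\forall j \near U, f j <= c) -> lim (f @ U) <= c.
Proof. by move=> bf cf; apply: limr_le => //; exact: ulim_cvg. Qed.

Lemma ulim_norm_le (c : R) (f : J -> R) :
  (forall j, `|f j| <= c) -> `|lim (f @ U)| <= c.
Proof.
move=> fc; have bf : bnd f by exists c.
rewrite ler_norml ulim_ge ?ulim_le//; near=> j.
  by have := fc j; rewrite ler_norml => /andP[].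
by have := fc j; rewrite ler_norml => /andP[].
Unshelve. all: end_near. Qed.

Lemma ulim_lt (c : R) (f : J -> R) : bnd f -> lim (f @ U) < c ->
  \forall j \near U, f j < c.
Proof. by move=> /ulim_cvg /cvgr_lt; apply. Qed.

Lemma ulim_gt (c : R) (f : J -> R) : bnd f -> c < lim (f @ U) ->
  \forall j \near U, c < f j.
Proof. by move=> /ulim_cvg /cvgr_gt; apply. Qed.

Lemma ulim_near (e : R) (f : J -> R) : bnd f -> 0 < e ->
  \forall j \near U, `|f j - lim (f @ U)| <= e.
Proof.
move=> /ulim_cvg /cvgrPdist_le h e0; move: (h _ e0).
by apply: filterS => j; rewrite distrC.
Qed.

End UltraLimits.

(** * Integration against finitely additive measures *)

Section PositiveFunctionals.
Context {R : realType} {T : Type}.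
Implicit Types (f g h : T -> R) (L : (T -> R) -> R).

(** Linearity is asked on bounded functions only, where ultrafilter limits are additive. No
    measurability enters: [posfun] models a finitely additive measure on all subsets of [T]. *)
Definition lin_on_bnd L := forall a f g, bnd f -> bnd g ->
  L (fun t => a * f t + g t) = a * L f + L g.

Definition posfun L :=
  lin_on_bnd L /\ (forall f, bnd f -> (forall t, 0 <= f t) -> 0 <= L f).

Section Linear.
Variables (L : (T -> R) -> R) (linL : lin_on_bnd L).

Lemma linbD f g : bnd f -> bnd g -> L (fun t => f t + g t) = L f + L g.
Proof.
move=> bf bg; have := linL 1 bf bg; rewrite mul1r => <-.
by congr L; apply/funext => t; rewrite mul1r.
Qed.

Lemma linb0 : L (fun=> 0) = 0.
Proof.
have := linbD (bnd_cst 0) (bnd_cst 0).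
have -> : (fun=> 0 + 0) = (fun=> 0) :> (T -> R) by apply/funext => t; rewrite addr0.
by move/eqP; rewrite -subr_eq0 opprD addNKr oppr_eq0 => /eqP.
Qed.

Lemma linbZ a f : bnd f -> L (fun t => a * f t) = a * L f.
Proof.
move=> bf; have := linL a bf (bnd_cst 0); rewrite linb0 addr0 => <-.
by congr L; apply/funext => t; rewrite addr0.
Qed.

Lemma linbN f : bnd f -> L (fun t => - f t) = - L f.
Proof.
move=> bf; have := linbZ (-1) bf; rewrite mulN1r => <-.
by congr L; apply/funext => t; rewrite mulN1r.
Qed.

Lemma linbB f g : bnd f -> bnd g -> L (fun t => f t - g t) = L f - L g.
Proof. by move=> bf bg; rewrite -linbN// -linbD//; bnd. Qed.

Lemma linb_sum (N : nat) (F : nat -> T -> R) : (forall i, bnd (F i)) ->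
  L (fun t => \sum_(i < N) F i t) = \sum_(i < N) L (F i).
Proof.
move=> bF; elim: N => [|N IH].
  by under eq_fun do rewrite big_ord0; rewrite linb0 big_ord0.
under eq_fun do rewrite big_ord_recr; rewrite linbD//; last exact: bnd_sum.
by rewrite IH [RHS]big_ord_recr.
Qed.

End Linear.

Section Positive.
Variables (nu : (T -> R) -> R) (pnu : posfun nu).

Lemma posfun_le f g : bnd f -> bnd g -> (forall t, f t <= g t) -> nu f <= nu g.
Proof.
move=> bf bg fg; rewrite -subr_ge0 -(linbB pnu.1)//; apply: pnu.2; first by bnd.
by move=> t; rewrite subr_ge0.
Qed.

Lemma posfun_abs f : bnd f -> `|nu f| <= nu (fun t => `|f t|).
Proof.
move=> bf; rewrite ler_norml -(linbN pnu.1); last by bnd.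
rewrite !posfun_le//; try bnd.
  by move=> t; exact: ler_norm.
by move=> t; rewrite lerNl -normrN ler_norm.
Qed.

Lemma posfun_cst c : nu (fun=> c) = c * nu (fun=> 1).
Proof.
rewrite -(linbZ pnu.1)//; last exact: bnd_cst.
by congr nu; apply/funext => t; rewrite mulr1.
Qed.

Lemma posfun_norm_le f c : (forall t, `|f t| <= c) -> `|nu f| <= c * nu (fun=> 1).
Proof.
move=> fc; have bf : bnd f by exists c.
rewrite (le_trans (posfun_abs bf))// -posfun_cst posfun_le//; bnd.
Qed.

End Positive.

Lemma ulim_linb (J : Type) (U : set_system J) {UU : UltraFilter U}
    (L : J -> (T -> R) -> R) :
  (forall f, bnd f -> bnd (L^~ f)) -> (forall j, lin_on_bnd (L j)) ->
  lin_on_bnd (fun f => lim (L^~ f @ U)).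
Proof.
move=> bL linL a f g bf bg /=; rewrite -ulim_lin//; [|exact: bL..].
by under eq_fun do rewrite linL//.
Qed.

Lemma ulim_posfun (J : Type) (U : set_system J) {UU : UltraFilter U}
    (L : J -> (T -> R) -> R) :
  (forall f, bnd f -> bnd (L^~ f)) -> (forall j, posfun (L j)) ->
  posfun (fun f => lim (L^~ f @ U)).
Proof.
move=> bL pL; split; first by apply: ulim_linb => // j; exact: (pL j).1.
move=> f bf f0; apply: ulim_ge; first exact: bL.
by near=> j; apply: (pL j).2.
Unshelve. all: end_near. Qed.

End PositiveFunctionals.

(** * Orthonormal sequences of signs *)

Section WeaklyNull.
Context {R : realType} {T : Type}.
Variables (nu : (T -> R) -> R) (r : nat -> T -> R).
Hypotheses (pnu : posfun nu) (nu1 : nu (fun=> 1) = 1).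
Hypothesis r2 : forall k t, r k t * r k t = 1.
Hypothesis orth : forall j k, j != k -> nu (fun t => r j t * r k t) = 0.

Let linnu := pnu.1.

Lemma rade_abs k t : `|r k t| = 1.
Proof.
apply/eqP; rewrite -(@eqrXn2 _ 2)//.
by rewrite real_normK ?num_real// expr1n expr2 r2.
Qed.

Lemma bnd_rade k : bnd (r k).
Proof. by exists 1 => t; rewrite rade_abs. Qed.

Local Hint Resolve bnd_rade : bnd.

(** Such an [L] behaves like integration against a bounded density with respect to [nu]. *)
Definition dominated (L : (T -> R) -> R) := lin_on_bnd L /\
  exists2 C : R, 0 <= C & forall f, bnd f -> `|L f| <= C * nu (fun t => `|f t|).

(** Pythagoras, by induction: [r N] is orthogonal to the sum of the preceding terms and has square
    1. *)
Lemma posfun_sqr_orth (c : nat -> R) N :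
  nu (fun t => (\sum_(k < N) c k * r k t) ^+ 2) = \sum_(k < N) c k ^+ 2.
Proof.
have bS n : bnd (fun t => \sum_(k < n) c k * r k t).
  by apply: (@bnd_sum _ _ n (fun k t => c k * r k t)) => i; bnd.
have Sr n m : (n <= m)%N -> nu (fun t => (\sum_(k < n) c k * r k t) * r m t) = 0.
  move=> nm; under eq_fun do rewrite mulr_suml.
  rewrite (@linb_sum _ _ _ linnu n (fun k t => c k * r k t * r m t)); last by move=> i; bnd.
  rewrite big1// => i _; under eq_fun do rewrite -mulrA.
  rewrite (linbZ linnu); last by bnd.
  by rewrite orth ?mulr0// neq_ltn (leq_trans (ltn_ord i) nm).
elim: N => [|N IH].
  rewrite big_ord0; under eq_fun do rewrite big_ord0 expr0n/=.
  exact: (linb0 linnu).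
rewrite big_ord_recr/= -IH.
have -> : (fun t => (\sum_(k < N.+1) c k * r k t) ^+ 2) =
   (fun t => (\sum_(k < N) c k * r k t) ^+ 2 +
      ((2 * c N) * ((\sum_(k < N) c k * r k t) * r N t) + c N ^+ 2)).
  apply/funext => t; rewrite big_ord_recr/=.
  have -> : c N ^+ 2 = c N ^+ 2 * (r N t * r N t) by rewrite r2 mulr1.
  by ring.
have bS2 : bnd (fun t => (\sum_(k < N) c k * r k t) ^+ 2).
  by under eq_fun do rewrite expr2; bnd.
rewrite (linbD linnu)//; last by bnd.
rewrite linnu//; try bnd.
by rewrite Sr// mulr0 add0r (posfun_cst pnu) nu1 mulr1.
Qed.

(* Bessel's inequality for the orthonormal sequence [r k]. *)
Lemma rade_weak_null L h : dominated L -> bnd h ->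
  (fun k => L (fun t => h t * r k t)) @ \oo --> 0.
Proof.
move=> [linL [C C0 LC]] /[dup] bh /bnd_pos[H H0 hH].
pose c k := L (fun t => h t * r k t).
pose D := C * H.
have le_q N : \sum_(k < N) c k ^+ 2 <= D ^+ 2.
  set q := \sum_(k < N) _.
  pose S t := \sum_(k < N) c k * r k t.
  have bS : bnd S by apply: (@bnd_sum _ _ N (fun k t => c k * r k t)) => i; bnd.
  have LS : L (fun t => h t * S t) = q.
    have -> : (fun t => h t * S t) = (fun t => \sum_(k < N) (c k * (h t * r k t))).
      by apply/funext => t; rewrite /S mulr_sumr; apply: eq_bigr => i _; ring.
    rewrite (@linb_sum _ _ _ linL N (fun k t => c k * (h t * r k t))); last by move=> i; bnd.
    by apply: eq_bigr => i _; rewrite (linbZ linL) ?expr2//; bnd.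
  have qD : q <= D * nu (fun t => `|S t|).
    rewrite -LS (le_trans (ler_norm _))// (le_trans (LC _ _))//; first by bnd.
    rewrite /D -mulrA ler_wpM2l// -(linbZ linnu); last by bnd.
    apply: (posfun_le pnu) => [||t]; try by bnd.
    by rewrite normrM ler_wpM2r.
  have bS2 : bnd (fun t => S t ^+ 2) by under eq_fun do rewrite expr2; bnd.
  (* Integrating [2 * D * |S| <= S ^+ 2 + D ^+ 2] turns [q <= D * nu |S|] into
     [2 * q <= q + D ^+ 2]. *)
  have : 2 * (D * nu (fun t => `|S t|)) <= q + D ^+ 2.
    have -> : D ^+ 2 = nu (fun=> D ^+ 2) by rewrite (posfun_cst pnu) nu1 mulr1.
    rewrite /q -posfun_sqr_orth -/S.
    rewrite -(linbD linnu)//; last by bnd.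
    rewrite mulrA -(linbZ linnu); last by bnd.
    apply: (posfun_le pnu) => [||t]; try by bnd.
    rewrite -/(S t); have <- : `|S t| ^+ 2 = S t ^+ 2 by rewrite real_normK ?num_real.
    have := sqr_ge0 (`|S t| - D). lra.
  lra.
have cv : cvgn (series (fun k => c k ^+ 2)).
  apply: nondecreasing_is_cvgn.
    by apply/nondecreasing_seqP => n; rewrite /series/= big_nat_recr//= lerDl sqr_ge0.
  by exists (D ^+ 2) => _ [n _ <-]; rewrite /series/= big_mkord.
have /cvgrPdist_lt c2 := cvg_series_cvg_0 cv.
apply/cvgrPdist_lt => e e0.
have e20 : 0 < e ^+ 2 by rewrite exprn_gt0.
near=> k; rewrite sub0r normrN -/(c k).
have : `|0 - c k ^+ 2| < e ^+ 2 by near: k; exact: c2.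
rewrite sub0r normrN normrX => h2.
by rewrite -(@ltr_pXn2r _ 2) ?nnegrE//= ltW.
Unshelve. all: end_near. Qed.

End WeaklyNull.

(** * Riesz products and l1 sequences *)

Lemma near_all_in (A : eqType) (J : Type) (F : set_system J) {FF : Filter F}
    (s : seq A) (P : A -> J -> Prop) :
  (forall a, a \in s -> \forall j \near F, P a j) ->
  \forall j \near F, forall a, a \in s -> P a j.
Proof.
elim: s => [_|a s IH H]; first by near=> j.
have Ha := H a (mem_head _ _).
have {IH}Hs := IH (fun b bs => H b (mem_behead (bs : b \in behead (a :: s)))).
near=> j => b; rewrite inE => /orP[/eqP->|]; first by near: j.
by move: b; near: j.
Unshelve. all: end_near. Qed.

Section RieszProducts.
Context {R : realType} {T : Type}.
Variables (nu : (T -> R) -> R) (r : nat -> T -> R).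
Hypotheses (pnu : posfun nu) (nu1 : nu (fun=> 1) = 1).
Hypothesis r2 : forall k t, r k t * r k t = 1.
Hypothesis orth : forall j k, j != k -> nu (fun t => r j t * r k t) = 0.
Variables (y : nat -> T -> R) (C : R).
Hypothesis yC : forall k t, `|y k t| <= C.
(** A side condition to be imposed on all pairs of chosen indices; it will express that the
    underlying times increase. *)
Variable Q : nat -> nat -> Prop.
Hypothesis HQ : forall l, \forall k \near \oo, Q l k.
Variables (U : set_system nat).
Hypotheses (UU : UltraFilter U) (Uoo : \oo `<=` U).

Let linnu := pnu.1.

Let bnd_r k : bnd (r k).
Proof. exact: bnd_rade. Qed.

Let bnd_y k : bnd (y k).
Proof. by exists C. Qed.

Local Hint Resolve bnd_r bnd_y : bnd.

(* These play the roles of weak limits of [y k] and of [y k * r k]. *)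
Definition mean_of h := lim ((fun k => nu (fun t => y k t * h t)) @ U).
Definition corr_of h := lim ((fun k => nu (fun t => y k t * (r k t * h t))) @ U).

Let nonemptyT : exists t : T, True.
Proof.
apply: contrapT => nT; have := nu1.
rewrite (_ : (fun=> 1) = (fun=> 0) :> (T -> R)).
  by rewrite (linb0 linnu) => /esym/eqP; rewrite oner_eq0.
by apply/funext => t; exfalso; apply: nT; exists t.
Qed.

Let C0 : 0 <= C.
Proof. by have [t _] := nonemptyT; exact: le_trans (yC 0 t). Qed.

Let dominated_mul g : (forall t, `|g t| <= C) -> lin_on_bnd (fun h => nu (fun t => g t * h t)) /\
  forall f, bnd f -> `|nu (fun t => g t * f t)| <= C * nu (fun t => `|f t|).
Proof.
move=> gC; have bg : bnd g by exists C.
split=> [a f h bf bh|f bf].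
  rewrite -linnu; try bnd.
  by congr nu; apply/funext => t; ring.
rewrite (le_trans (posfun_abs pnu _))//; first by bnd.
rewrite -(linbZ linnu); last by bnd.
apply: (posfun_le pnu) => [||t]; try by bnd.
by rewrite normrM ler_wpM2r.
Qed.

Let yrC k t : `|y k t * r k t| <= C.
Proof. by rewrite normrM (rade_abs r2) mulr1. Qed.

Let dominated_y k : dominated nu (fun h => nu (fun t => y k t * h t)).
Proof.
by have [lin H] := dominated_mul (yC k); split => //; exists C.
Qed.

Let dominated_nu : dominated nu nu.
Proof. by split => //; exists 1 => // f bf; rewrite mul1r; exact: posfun_abs. Qed.

Let bnd_seq g : (forall k t, `|g k t| <= C) -> forall f, bnd f ->
  bnd (fun k : nat => nu (fun t => g k t * f t)).
Proof.
by move=> gC f bf; exists (C * nu (fun t => `|f t|)) => k; apply: (dominated_mul (gC k)).2.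
Qed.

Let dominated_lim g : (forall k t, `|g k t| <= C) ->
  dominated nu (fun h => lim ((fun k : nat => nu (fun t => g k t * h t)) @ U)).
Proof.
move=> gC; split.
  apply: ulim_linb; first exact: bnd_seq.
  by move=> j; exact: (dominated_mul (gC j)).1.
exists C => //.
by move=> f bf; apply: ulim_norm_le => k; apply: (dominated_mul (gC k)).2.
Qed.

Let corrE h : corr_of h = lim ((fun k => nu (fun t => (y k t * r k t) * h t)) @ U).
Proof.
by rewrite /corr_of; congr (lim (_ @ U)); apply/funext => k; congr nu;
  apply/funext => t; rewrite mulrA.
Qed.

Let dominated_mean : dominated nu mean_of.
Proof. exact: dominated_lim. Qed.

Let dominated_corr : dominated nu corr_of.
Proof.
have -> : corr_of = fun h => lim ((fun k => nu (fun t => (y k t * r k t) * h t)) @ U).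
  by apply/funext => h; rewrite corrE.
exact: (dominated_lim yrC).
Qed.

Let small L P (eta : R) : dominated nu L -> bnd P -> 0 < eta ->
  \forall k \near U, `|L (fun t => P t * r k t)| <= eta.
Proof.
move=> domL bP eta0; apply: Uoo.
have /cvgrPdist_le/(_ _ eta0) := rade_weak_null pnu nu1 r2 orth domL bP.
by apply: filterS => k; rewrite sub0r normrN.
Qed.

(** All choices of signs are listed, so that a new index can be tested against every possible
    product at once. *)
Fixpoint riesz_products (s : seq nat) : seq (T -> R) :=
  if s is k :: s' then
    [seq (fun t => P t * (1 + r k t)) | P <- riesz_products s'] ++
    [seq (fun t => P t * (1 - r k t)) | P <- riesz_products s']
  else [:: fun=> 1].

Lemma bnd_riesz s P : P \in riesz_products s -> bnd P.
Proof.
elim: s P => [|k s IH] P /=; first by rewrite inE => /eqP ->; bnd.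
by rewrite mem_cat => /orP[] /mapP[P' /IH bP' ->]; bnd.
Qed.

(** The first three bounds say that a further factor containing [r k] hardly changes [mean_of],
    [corr_of] and [nu]. The next two say that [y k] and [y k * r k] are near their weak limits
    against the products already built, and the last one that the earlier [y l] hardly see the new
    factor. *)
Definition admissible (eta : R) (s : seq nat) (k : nat) :=
  (forall P, P \in riesz_products s ->
     [/\ `|mean_of (fun t => P t * r k t)| <= eta,
         `|corr_of (fun t => P t * r k t)| <= eta,
         `|nu (fun t => P t * r k t)| <= eta,
         `|nu (fun t => y k t * P t) - mean_of P| <= eta &
         `|nu (fun t => y k t * (r k t * P t)) - corr_of P| <= eta] /\
     forall l, l \in s -> `|nu (fun t => y l t * (P t * r k t))| <= eta) /\
  (forall l, l \in s -> Q l k).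

(** Finitely many conditions, each valid on a member of [U]: smallness comes from Bessel's
    inequality, since [U] refines [\oo], and closeness from the definition of the limits along
    [U]. *)
Lemma admissible_ex eta s : 0 < eta -> exists k, admissible eta s k.
Proof.
move=> eta0; apply: (@filter_ex _ U).
apply: filterI; last by apply: near_all_in => l _; apply: Uoo; exact: HQ.
apply: near_all_in => P /bnd_riesz bP.
have h1 := small dominated_mean bP eta0.
have h2 := small dominated_corr bP eta0.
have h3 := small dominated_nu bP eta0.
have h4 : \forall k \near U, `|nu (fun t => y k t * P t) - mean_of P| <= eta.
  by apply: ulim_near => //; exact: bnd_seq.
have h5 : \forall k \near U, `|nu (fun t => y k t * (r k t * P t)) - corr_of P| <= eta.
  apply: ulim_near => //; have [D hD] := bnd_seq yrC bP.
  by exists D => k; under [X in nu X]eq_fun do rewrite mulrA.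
have h6 : \forall k \near U, forall l, l \in s ->
    `|nu (fun t => y l t * (P t * r k t))| <= eta.
  by apply: near_all_in => l _; exact: small (dominated_y l) bP eta0.
near=> k; split; first split; [near: k; exact: h1|near: k; exact: h2|near: k; exact: h3
  |near: k; exact: h4|near: k; exact: h5|near: k; exact: h6].
Unshelve. all: end_near. Qed.

Variables (delta : R) (d0 : 0 < delta).
Hypothesis yr : forall k, delta <= nu (fun t => y k t * r k t).

(** Along admissible indices, a Riesz product [P e] is nonnegative of mass at most 2, and testing
    [y (kappa i)] against it gives nearly the mean plus or minus the correlation, with the sign
    [e i]. Testing a combination against the products for the signs of [a] and for the opposite
    signs, then subtracting, cancels the means and leaves a multiple of the sum of the [|a i|]. *)
Lemma riesz_l1 : exists (kappa : nat -> nat) (c : R),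
  [/\ 0 < c, forall i j, (i < j)%N -> Q (kappa i) (kappa j) &
      forall (N : nat) (a : nat -> R) (B : R),
        (forall t, `|\sum_(i < N) a i * y (kappa i) t| <= B) ->
        c * \sum_(i < N) `|a i| <= B].
Proof.
(* Two errors of [4 * eta] must cost at most [delta]; the bound 1 keeps the masses below 2. *)
pose eta := Num.min (delta / 8) 1.
have eta0 : 0 < eta by rewrite lt_min divr_gt0//=.
have eta1 : eta <= 1 by rewrite ge_min lexx orbT.
have etad : 8 * eta <= delta.
  by rewrite -ler_pdivlMl// mulrC ge_min lexx.
(* Geometric tolerances: the [et j] with [m <= j < N] add up to [2 * et m - 2 * et N], and all of
   them to [eta]. *)
pose et (j : nat) := eta / 2 ^+ j.+1.
have et0 j : 0 < et j by rewrite divr_gt0// exprn_gt0.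
have et_le j : 2 * et j <= eta.
  rewrite /et exprS invfM !mulrA [2 * eta]mulrC mulfK// ler_piMr ?(ltW eta0)//.
  by rewrite invf_le1 ?exprn_gt0// exprn_ege1// ler1n.
have etS j : et j.+1 = et j / 2 by rewrite /et [in LHS]exprS invfM; ring.
have [nxt nxtP] := choice (fun s => admissible_ex s (et0 (size s))).
pose hist := fix hist j := if j is j'.+1 then nxt (hist j') :: hist j' else [::].
pose kappa j := nxt (hist j).
have size_hist j : size (hist j) = j by elim: j => //= j ->.
have mem_hist i j : (i < j)%N -> kappa i \in hist j.
  elim: j => // j IH; rewrite ltnS leq_eqVlt => /orP[/eqP ->|/IH h] /=.
    exact: mem_head.
  by rewrite inE h orbT.
have adm j : admissible (et j) (hist j) (kappa j).
  by have := nxtP (hist j); rewrite size_hist.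
pose sg (b : bool) : R := if b then 1 else -1.
pose P (e : nat -> bool) := fix P (j : nat) : T -> R :=
  if j is j'.+1 then fun t => P j' t * (1 + sg (e j') * r (kappa j') t) else fun=> 1.
have P_mem e j : P e j \in riesz_products (hist j).
  elim: j => [|j IH] /=; first exact: mem_head.
  rewrite mem_cat; apply/orP; rewrite /sg; case: (e j); [left|right]; apply/mapP.
    by exists (P e j) => //; apply/funext => t; rewrite mul1r.
  by exists (P e j) => //; apply/funext => t; rewrite mulN1r.
have bP e j : bnd (P e j) := bnd_riesz (P_mem e j).
have sgM b (z : R) : `|sg b * z| = `|z|.
  by rewrite /sg; case: b; rewrite ?mul1r// mulN1r normrN.
have P_ge0 e j t : 0 <= P e j t.
  elim: j => //= j IH; rewrite mulr_ge0//.
  have : `|sg (e j) * r (kappa j) t| <= 1 by rewrite sgM (rade_abs r2).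
  by rewrite ler_norml => /andP[+ _]; rewrite lerNl -subr_ge0 opprK.
(* Each new factor changes [L (P e j)] by plus or minus [L (P e j * r (kappa j))]; the changes are
   summed. *)
have tele L e m N : lin_on_bnd L -> (m <= N)%N ->
    (forall j, (m <= j < N)%N -> `|L (fun t => P e j t * r (kappa j) t)| <= et j) ->
    `|L (P e N) - L (P e m)| <= 2 * et m - 2 * et N.
  move=> linL /subnKC <-; elim: (N - m)%N => [_|d IH H].
    by rewrite addn0 !subrr normr0.
  have -> : L (P e (m + d.+1)%N) = L (P e (m + d)%N) +
      sg (e (m + d)%N) * L (fun t => P e (m + d)%N t * r (kappa (m + d)%N) t).
    rewrite -(linbZ linL); last by bnd.
    rewrite -(linbD linL); try bnd.
    by rewrite addnS /=; congr L; apply/funext => t; ring.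
  have h1 := IH (fun j hj => H j ltac:(lia)).
  have h2 := H (m + d)%N ltac:(lia).
  rewrite addrAC (le_trans (ler_normD _ _))// sgM.
  by rewrite addnS etS; lra.
(* The factors before [i] are compared with 1 through the weak limits, the factor [i] splits the
   integral into a mean and a correlation, and the factors after [i] change it little. *)
have est e N i : (i < N)%N ->
    `|nu (fun t => y (kappa i) t * P e N t)
      - (mean_of (fun=> 1) + sg (e i) * corr_of (fun=> 1))| <= 4 * eta.
  move=> iN.
  have ha : `|mean_of (P e i) - mean_of (fun=> 1)| <= 2 * et 0%N - 2 * et i.
    apply: (tele mean_of e 0%N i dominated_mean.1) => // j _.
    by have [[]] := (adm j).1 _ (P_mem e j).
  have hb : `|corr_of (P e i) - corr_of (fun=> 1)| <= 2 * et 0%N - 2 * et i.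
    apply: (tele corr_of e 0%N i dominated_corr.1) => // j _.
    by have [[]] := (adm j).1 _ (P_mem e j).
  have hd : `|nu (fun t => y (kappa i) t * P e N t) -
              nu (fun t => y (kappa i) t * P e i.+1 t)| <= 2 * et i.+1 - 2 * et N.
    apply: (tele (fun h => nu (fun t => y (kappa i) t * h t)) e _ _ (dominated_y _).1 iN).
    move=> j /andP[ij _]; have [_] := (adm j).1 _ (P_mem e j).
    by apply; exact: mem_hist.
  have [[_ _ _ hc1 hc2] _] := (adm i).1 _ (P_mem e i).
  have hc : nu (fun t => y (kappa i) t * P e i.+1 t) =
      nu (fun t => y (kappa i) t * P e i t) +
      sg (e i) * nu (fun t => y (kappa i) t * (r (kappa i) t * P e i t)).
    rewrite -(linbZ linnu); last by bnd.
    by rewrite -(linbD linnu); try bnd; congr nu; apply/funext => t /=; ring.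
  have e0 := et_le 0%N; have ei := et_le i; have ei0 := et0 i; have eN := et0 N.
  have ei1 := et_le i.+1; have ei10 := et0 i.+1.
  move: ha hb hd hc1 hc2; rewrite hc /sg !ler_norml.
  case: (e i) => /andP[? ?] /andP[? ?] /andP[? ?] /andP[? ?] /andP[? ?];
  apply/andP; split; lra.
have nuP e N : nu (P e N) <= 2.
  have adm3 j : `|nu (fun t => P e j t * r (kappa j) t)| <= et j.
    by have [[]] := (adm j).1 _ (P_mem e j).
  have := tele nu e 0%N N linnu (leq0n _) (fun j _ => adm3 j).
  rewrite /= nu1 ler_norml => /andP[_].
  by have := et_le 0%N; have := et0 N; lra.
have corr1 : delta <= corr_of (fun=> 1).
  apply: ulim_ge; last by near=> k; under [X in nu X]eq_fun do rewrite mulr1.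
  by have [D hD] := bnd_seq yrC (bnd_cst 1); exists D => k;
    under [X in nu X]eq_fun do rewrite mulrA.
exists kappa, (delta / 4); split; first by rewrite divr_gt0.
  by move=> i j ij; apply: (adm j).2; exact: mem_hist.
move=> N a B yB.
(* The signs of the coefficients and their opposites; for each [i] the two tests differ by twice the
   correlation up to [8 * eta], hence by at least [delta]. *)
pose e i := 0 <= a i.
pose e' i := ~~ (0 <= a i).
have B0 : 0 <= B by have [t _] := nonemptyT; exact: le_trans (yB t).
have test f : nu (fun t => (\sum_(i < N) a i * y (kappa i) t) * P f N t) =
    \sum_(i < N) a i * nu (fun t => y (kappa i) t * P f N t).
  under eq_fun do rewrite mulr_suml.
  rewrite (@linb_sum _ _ _ linnu N (fun i t => a i * y (kappa i) t * P f N t)); last first.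
    by move=> i; bnd.
  by apply: eq_bigr => i _; rewrite -(linbZ linnu); [under eq_fun do rewrite -mulrA|bnd].
have testB f : `|nu (fun t => (\sum_(i < N) a i * y (kappa i) t) * P f N t)| <= 2 * B.
  have bS : bnd (fun t => \sum_(i < N) a i * y (kappa i) t) by exists B.
  rewrite (le_trans (posfun_abs pnu _))//; first by bnd.
  apply: (@le_trans _ _ (B * nu (P f N))); last by rewrite mulrC ler_wpM2r.
  rewrite -(linbZ linnu)//; apply: (posfun_le pnu) => [||t]; try by bnd.
  by rewrite normrM (ger0_norm (P_ge0 _ _ _)) ler_wpM2r.
have key : delta * \sum_(i < N) `|a i| <=
    \sum_(i < N) a i * nu (fun t => y (kappa i) t * P e N t) -
    \sum_(i < N) a i * nu (fun t => y (kappa i) t * P e' N t).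
  rewrite -sumrB mulr_sumr; apply: ler_sum => i _.
  have := est e N i (ltn_ord i); have := est e' N i (ltn_ord i).
  rewrite /sg /e /e' -mulrBr !ler_norml; have [a0|a0] := leP 0 (a i) => /=.
    move=> /andP[? ?] /andP[? ?]; rewrite ger0_norm// mulrC.
    by apply: ler_wpM2l => //; lra.
  move=> /andP[? ?] /andP[? ?]; rewrite ltr0_norm// -[leRHS]mulrNN mulrC.
  by apply: ler_wpM2l; lra.
move: key; rewrite -!test.
have := testB e; have := testB e'; rewrite !ler_norml => /andP[? ?] /andP[? ?] ?.
lra.
Unshelve. all: end_near. Qed.

End RieszProducts.

(** * Independent sequences *)

Section Independence.
Context {R : realType} {T : Type}.

(** Rosenthal's notion, stated for finite patterns over initial segments of the sequence. *)
Definition independent (g : nat -> T -> R) (a b : R) :=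
  forall (K : nat) (tau : nat -> bool), exists t, forall k, (k < K)%N ->
    if tau k then b <= g k t else g k t <= a.

(** A binary tree of good sets is grown level by level. A level is finite, so a single index [j]
    splits all its sets at once, and a branch of the tree realizes a pattern. *)
Lemma independent_of_tree (J : Type) (F : set_system J) {FF : ProperFilter F}
    (g : J -> T -> R) (a b : R) (good : set (set T)) :
  good !=set0 -> (forall A, good A -> A !=set0) ->
  (forall A, good A -> \forall j \near F,
     (exists2 A', good A' & A' `<=` A `&` [set t | g j t <= a]) /\
     (exists2 A', good A' & A' `<=` A `&` [set t | b <= g j t])) ->
  exists al : nat -> J, independent (g \o al) a b.
Proof.
move=> [A0 gA0] gne step.
pose all_good (s : seq (set T)) := forall A, A \in s -> good A.
pose refines j (s s' : seq (set T)) := forall A, A \in s ->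
  (exists2 A', A' \in s' & A' `<=` A `&` [set t | g j t <= a]) /\
  (exists2 A', A' \in s' & A' `<=` A `&` [set t | b <= g j t]).
have stepj j s : (forall A, A \in s ->
     (exists2 A', good A' & A' `<=` A `&` [set t | g j t <= a]) /\
     (exists2 A', good A' & A' `<=` A `&` [set t | b <= g j t])) ->
    exists2 s', all_good s' & refines j s s'.
  elim: s => [_|A s IH H]; first by exists [::].
  have [|s' gs' rs'] := IH; first by move=> B Bs; apply: H; rewrite inE Bs orbT.
  have [[A1 gA1 sA1] [A2 gA2 sA2]] := H A (mem_head _ _).
  exists [:: A1, A2 & s'].
    by move=> B; rewrite !inE => /or3P[/eqP->|/eqP->|/gs'].
  move=> B; rewrite inE => /orP[/eqP->|/rs'[[B1 B1s sB1] [B2 B2s sB2]]].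
    by split; [exists A1|exists A2] => //; rewrite !inE eqxx ?orbT.
  by split; [exists B1|exists B2] => //; rewrite !inE (B1s, B2s) !orbT.
(* Stated as an implication so that [choice] gives a total function; a list with a bad member gets
   an arbitrary successor. *)
have nextP s : exists js : J * seq (set T),
    all_good s -> all_good js.2 /\ refines js.1 s js.2.
  have [gs|ngs] := pselect (all_good s); last first.
    by have [j _] := filter_ex (@filterT _ F _); exists (j, s) => /ngs.
  have [j jP] := @filter_ex _ F _ _ (near_all_in (fun A As => step A (gs A As))).
  by have [s' gs' rs'] := stepj j s jP; exists (j, s').
have [nxt nxtP] := choice nextP.
pose st := fix st k := if k is k'.+1 then (nxt (st k')).2 else [:: A0].
have gst k : all_good (st k).
  elim: k => [A|k IH]; first by rewrite inE => /eqP->.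
  exact: (nxtP _ IH).1.
exists (fun k => (nxt (st k)).1) => K tau.
suff [A As At] : exists2 A, A \in st K & forall t, A t -> forall k, (k < K)%N ->
    if tau k then b <= g (nxt (st k)).1 t else g (nxt (st k)).1 t <= a.
  by have [t /At] := gne A (gst _ _ As); exists t.
elim: K => [|K [A As At]]; first by exists A0 => //; rewrite mem_head.
have [[A1 A1s sA1] [A2 A2s sA2]] := (nxtP _ (gst K)).2 A As.
case: (boolP (tau K)) => tK; [exists A2|exists A1] => //= t;
  [move=> /sA2[/At h ?]|move=> /sA1[/At h ?]] => k;
  by rewrite ltnS leq_eqVlt => /orP[/eqP->|/h//]; rewrite ?tK ?(negbTE tK).
Qed.

(* [nu] is a fair-coin functional carried by points realizing all patterns, and
   [r k] tells on which side of the gap [g k] lies. *)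
Lemma independent_rademacher (g : nat -> T -> R) (a b : R) (C : R) :
  (forall k t, `|g k t| <= C) -> independent g a b -> a < b ->
  exists (nu : (T -> R) -> R) (r : nat -> T -> R),
  [/\ posfun nu, nu (fun=> 1) = 1, forall k t, r k t * r k t = 1,
    forall j k, j != k -> nu (fun t => r j t * r k t) = 0 &
    forall k, (b - a) / 2 <= nu (fun t => g k t * r k t)].
Proof.
move=> gC ind ab.
have [pt ptP] := choice (fun Kt : nat * (nat -> bool) => ind Kt.1 Kt.2).
pose r k t : R := if b <= g k t then 1 else -1.
(* Finite patterns are extended by [false], so that [pt] applies to them. *)
pose ext K (tau : {ffun 'I_K -> bool}) (k : nat) :=
  if insub k is Some i then tau i else false.
have extE K (tau : {ffun 'I_K -> bool}) (i : 'I_K) : ext K tau i = tau i.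
  by rewrite /ext valK.
pose p K (tau : {ffun 'I_K -> bool}) := pt (K, ext K tau).
have pP K (tau : {ffun 'I_K -> bool}) (i : 'I_K) :
    if tau i then b <= g i (p K tau) else g i (p K tau) <= a.
  by have := ptP (K, ext K tau) i (ltn_ord i); rewrite /= extE.
have rp K (tau : {ffun 'I_K -> bool}) (i : 'I_K) : r i (p K tau) = if tau i then 1 else -1.
  rewrite /r; have := pP K tau i; case: (tau i) => [->//|h].
  by rewrite leNgt (le_lt_trans h ab).
pose flip K (i : 'I_K) (tau : {ffun 'I_K -> bool}) : {ffun 'I_K -> bool} :=
  [ffun j => (j == i) (+) tau j].
have flip_inj K (i : 'I_K) : injective (flip K i).
  by apply: inv_inj => tau; apply/ffunP => j; rewrite !ffunE addbA addbb.
have r2 k t : r k t * r k t = 1.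
  by rewrite /r; case: ifP; rewrite ?mulr1// mulrNN mulr1.
(* The uniform average over the [2 ^+ K] points realizing the patterns of length [K]; [nu] is its
   limit along an ultrafilter. *)
pose av K (h : T -> R) := (2 ^+ K)^-1 * \sum_tau h (p K tau).
have pow0 K : 0 < (2 ^+ K)^-1 :> R by rewrite invr_gt0 exprn_gt0.
have card K : \sum_(tau : {ffun 'I_K -> bool}) (1 : R) = 2 ^+ K.
  by rewrite sumr_const card_ffun card_bool card_ord natrX.
have av_pos K : posfun (av K).
  split=> [c f h _ _|f _ f0]; last by rewrite mulr_ge0// ?(ltW (pow0 _))// sumr_ge0.
  by rewrite /av big_split/= -mulr_sumr; ring.
have av1 K : av K (fun=> 1) = 1 by rewrite /av card mulVf// expf_neq0.
have av_bnd f : bnd f -> bnd (av^~ f).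
  by move=> [D fD]; exists D => K; have := posfun_norm_le (av_pos K) fD; rewrite av1 mulr1.
have [U [UU Uoo]] := @ultraFilterLemma nat \oo _.
exists (fun h => lim ((av^~ h) @ U)), r.
have br k : bnd (r k).
  by exists 1 => t; rewrite /r; case: ifP; rewrite ?normrN normr1.
have bg k : bnd (g k) by exists C.
split => //.
- exact: ulim_posfun.
- by apply: ulimP; under eq_fun do rewrite av1; exact: cvg_cst.
- move=> j k jk; apply: ulimP; apply: cvg_near_cst.
  apply: Uoo; exists (maxn j k).+1 => // K /=; rewrite gtn_max => /andP[jK kK].
  rewrite /av; set S := \sum_tau _; suff -> : S = 0 by rewrite mulr0.
  (* Flipping bit [j] permutes the patterns, reverses [r j] and keeps [r k]. *)
  have : S = - S.
    rewrite [LHS](reindex_inj (flip_inj K (Ordinal jK))) -sumrN.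
    apply: eq_bigr => tau _.
    rewrite (rp K (flip K _ tau) (Ordinal jK)) (rp K (flip K _ tau) (Ordinal kK)).
    rewrite (rp K tau (Ordinal jK)) (rp K tau (Ordinal kK)) !ffunE eqxx.
    have /negbTE -> : Ordinal kK != Ordinal jK by rewrite -val_eqE/= eq_sym.
    by case: (tau _); case: (tau _) => /=; rewrite ?mulrN ?mulNr ?mulr1 ?opprK.
  by move=> h; lra.
- move=> k; apply: ulim_ge; first by apply: av_bnd; bnd.
  apply: Uoo; exists k.+1 => // K /= kK.
  rewrite /av; set S := \sum_tau _.
  (* Each pattern is paired with the one differing at bit [k]: one contributes at least [b], the
     other at least [- a]. *)
  have : 2 ^+ K * (b - a) <= S + S.
    pose F tau := g k (p K tau) * r k (p K tau).
    have -> : S + S = \sum_tau (F (flip K (Ordinal kK) tau) + F tau).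
      by rewrite big_split/= [X in X + _ = _](reindex_inj (flip_inj K (Ordinal kK))).
    rewrite /F -card mulr_suml; apply: ler_sum => tau _; rewrite mul1r.
    rewrite (rp K (flip K _ tau) (Ordinal kK)) (rp K tau (Ordinal kK)).
    have := pP K tau (Ordinal kK); have := pP K (flip K (Ordinal kK) tau) (Ordinal kK).
    by rewrite !ffunE eqxx/=; case: (tau _) => /=; lra.
  by move=> h; rewrite ler_pdivlMl ?exprn_gt0//; lra.
Qed.

(** The pair [mn] gives a length and a starting time, both shifted by one: blocks are nonempty and
    involve positive times only, as tameness requires. *)
Definition block_mean (x : nat -> T -> R) (mn : nat * nat) (t : T) :=
  (mn.1.+1%:R)^-1 * \sum_(i < mn.1.+1) x (mn.2.+1 + i)%N t.

Lemma block_mean_le x C mn t : (forall i t, `|x i t| <= C) -> `|block_mean x mn t| <= C.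
Proof.
move=> xC; rewrite /block_mean normrM ger0_norm// ler_pdivrMl ?ltr0Sn//.
rewrite (le_trans (ler_norm_sum _ _ _))//.
apply: le_trans (ler_sum _ (fun i _ => xC _ t)) _.
by rewrite sumr_const card_ord mulr_natl.
Qed.

(** If a block mean correlates with [r k] by [delta], some term of the block does so as well. These
    terms, at times [idx k], feed [riesz_l1]. *)
Lemma independent_block_means_l1 (x : nat -> T -> R) (C : R)
    (mn : nat -> nat * nat) (a b : R) :
  (forall i t, `|x i t| <= C) -> a < b ->
  independent (fun k => block_mean x (mn k)) a b ->
  exists (iota : nat -> nat) (c : R),
  [/\ 0 < c, increasing_seq iota, forall k, (0 < iota k)%N &
      forall (N : nat) (al : nat -> R) (B : R),
        (forall t, `|\sum_(i < N) al i * x (iota i) t| <= B) ->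
        c * \sum_(i < N) `|al i| <= B].
Proof.
move=> xC ab ind.
have [nu [r [pnu nu1 r2 orth corr]]] :=
  independent_rademacher (fun k t => block_mean_le (mn k) t xC) ind ab.
have bx i : bnd (x i) by exists C.
have br k : bnd (r k) by exact: bnd_rade.
pose delta := (b - a) / 2.
have delta0 : 0 < delta by rewrite divr_gt0 ?subr_gt0.
have idxP k : exists i, (0 < i)%N /\ delta <= nu (fun t => x i t * r k t).
  apply: contrapT => /forallNP no.
  have := corr k; apply/negP; rewrite -ltNge.
  have -> : nu (fun t => block_mean x (mn k) t * r k t) =
     ((mn k).1.+1%:R)^-1 * \sum_(i < (mn k).1.+1)
        nu (fun t => x ((mn k).2.+1 + i)%N t * r k t).
    rewrite -(@linb_sum _ _ _ pnu.1 _ (fun i t => x ((mn k).2.+1 + i)%N t * r k t)); last first.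
      by move=> i; bnd.
    rewrite -(linbZ pnu.1); last first.
      by apply: (@bnd_sum _ _ _ (fun i t => x ((mn k).2.+1 + i)%N t * r k t)) => i; bnd.
    by congr nu; apply/funext => t; rewrite /block_mean -mulrA mulr_suml.
  rewrite ltr_pdivrMl ?ltr0Sn//.
  have -> : (mn k).1.+1%:R * ((b - a) / 2) = \sum_(i < (mn k).1.+1) delta.
    by rewrite sumr_const card_ord mulr_natl.
  apply: ltr_sum => [|i _]; first by apply/hasP; exists ord0 => //; rewrite mem_index_enum.
  rewrite ltNge; apply/negP => h; apply: (no ((mn k).2.+1 + i)%N).
  by split => //; rewrite addSn.
have [idx /all_and2[idx0 idxd]] := choice idxP.
(* The correlation of a fixed [x j] with [r k] tends to 0, so no time is chosen infinitely often and
   [idx] tends to infinity. *)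
have avoid j : \forall k \near \oo, idx k <> j.
  have domx : dominated nu (fun h => nu (fun t => x j t * h t)).
    split=> [c f h bf bh|].
      by rewrite -pnu.1; try bnd; congr nu; apply/funext => t; ring.
    exists `|C| => // f bf; rewrite (le_trans (posfun_abs pnu _))//; first by bnd.
    rewrite -(linbZ pnu.1); last by bnd.
    apply: (posfun_le pnu) => [||t]; try by bnd.
    by rewrite normrM ler_wpM2r// (le_trans (xC _ _))// ler_norm.
  have /cvgrPdist_lt/(_ _ delta0) := rade_weak_null pnu nu1 r2 orth domx (bnd_cst 1).
  apply: filterS => k + kj; rewrite sub0r normrN => /ltr_normlW.
  by under eq_fun do rewrite mul1r; rewrite ltNge -kj idxd.
have later l : \forall k \near \oo, (idx l < idx k)%N.
  have : \forall k \near \oo, forall j, j \in iota 0 (idx l).+1 -> idx k <> j.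
    by apply: near_all_in => j _; exact: avoid.
  apply: filterS => k h; rewrite ltnNge; apply/negP => kl.
  by apply: (h (idx k)) => //; rewrite mem_iota add0n ltnS kl.
have [U [UU Uoo]] := @ultraFilterLemma nat \oo _.
have [kappa [c [c0 inc l1]]] := riesz_l1 pnu nu1 r2 orth (fun k => xC (idx k))
  later UU Uoo delta0 idxd.
exists (idx \o kappa), c; split => //=.
by apply/increasing_seqP => n; rewrite ltEnat/=; exact: inc.
Qed.

End Independence.

(** * Ultrafilter limits of continuous functions *)

Section UltraDominatedConvergence.
Context {R : realType}.

(* If the [z j] were asymptotically orthogonal, sums [S] of [K] of them would
   satisfy [nu (h * S) >= K * p] but only [nu (h * S ^+ 2) = O(K)]. *)
Lemma ultra_correlation (T J : Type) (U : set_system J) (nu : (T -> R) -> R)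
    (h : T -> R) (z : J -> T -> R) (C p : R) : UltraFilter U ->
  posfun nu -> nu (fun=> 1) = 1 -> (forall t, 0 <= h t <= 1) ->
  (forall j t, 0 <= z j t <= C) -> 0 < p ->
  (\forall j \near U, p <= nu (fun t => h t * z j t)) ->
  \forall j \near U, 0 < lim ((fun k => nu (fun t => h t * z j t * z k t)) @ U).
Proof.
move=> UU pnu nu1 h01 zC p0 pz.
pose G f := lim ((fun k => nu (fun t => h t * f t * z k t)) @ U).
have [//|nA] := in_ultra_setVsetC [set j | 0 < G (z j)] UU.
exfalso.
have linnu := pnu.1.
have bh : bnd h.
  by exists 1 => t; have /andP[h0 h1] := h01 t; rewrite ger0_norm.
have zn j t : `|z j t| <= C by have /andP[z0 z1] := zC j t; rewrite ger0_norm.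
have bz j : bnd (z j) by exists C.
have bGs f : bnd f -> bnd (fun k => nu (fun t => h t * f t * z k t)).
  move=> [D fD]; exists (D * C) => k.
  rewrite -[leRHS]mulr1 -nu1; apply: (posfun_norm_le pnu) => t.
  have hn : `|h t| <= 1 by have /andP[h0 h1] := h01 t; rewrite ger0_norm.
  by rewrite !normrM ler_pM// -[leRHS]mul1r ler_pM.
(* Some [z j] with [G (z j) <= 0] is added at each stage. As [G S <= 0], most [j] satisfy
   [nu (h * S * z j) < 1], so [nu (h * S ^+ 2)] grows by at most [2 + C ^+ 2]. *)
have build (K : nat) : exists S, [/\ bnd S, G S <= 0,
    nu (fun t => h t * S t ^+ 2) <= K%:R * (2 + C ^+ 2) &
    K%:R * p <= nu (fun t => h t * S t)].
  elim: K => [|K [S [bS GS S2 S1]]].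
    exists (fun=> 0); split; first exact: bnd_cst.
    - rewrite /G; apply: ulim_le; first by apply: bGs; bnd.
      near=> k; rewrite (_ : (fun t => _) = fun=> 0) ?(linb0 linnu)//.
      by apply/funext => t; rewrite mulr0 mul0r.
    - rewrite mul0r (_ : (fun t => _) = fun=> 0) ?(linb0 linnu)//.
      by apply/funext => t; rewrite expr0n mulr0.
    - rewrite mul0r (_ : (fun t => _) = fun=> 0) ?(linb0 linnu)//.
      by apply/funext => t; rewrite mulr0.
  have near1 : \forall j \near U, nu (fun t => h t * S t * z j t) < 1.
    by apply: ulim_lt; [exact: bGs|rewrite (le_lt_trans GS)].
  have [j [[/negP + pj] Sj]] := filter_ex (filterI (filterI nA pz) near1).
  rewrite -leNgt => Gj.
  exists (fun t => S t + z j t); split; first by bnd.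
  - rewrite /G (_ : (fun k => _) = fun k => 1 * nu (fun t => h t * S t * z k t) +
        nu (fun t => h t * z j t * z k t)); last first.
      apply/funext => k; rewrite mul1r -(linbD linnu); try bnd.
      by congr nu; apply/funext => t; ring.
    rewrite ulim_lin; [|exact: bGs|exact: bGs].
    by move: GS Gj; rewrite /G; lra.
  - have -> : (fun t => h t * (S t + z j t) ^+ 2) =
       (fun t => h t * S t ^+ 2 + (2 * (h t * S t * z j t) + h t * z j t ^+ 2)).
      by apply/funext => t; ring.
    have bS2 : bnd (fun t => S t ^+ 2) by under eq_fun do rewrite expr2; bnd.
    have bz2 : bnd (fun t => z j t ^+ 2) by under eq_fun do rewrite expr2; bnd.
    rewrite (linbD linnu); try bnd.
    rewrite linnu; try bnd.
    have : nu (fun t => h t * z j t ^+ 2) <= C ^+ 2.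
      rewrite -[leRHS]mulr1 -nu1 -(posfun_cst pnu); apply: (posfun_le pnu) => [||t]; try by bnd.
      have /andP[h0 h1] := h01 t; have /andP[z0 z1] := zC j t.
      by rewrite -[leRHS]mul1r ler_pM ?sqr_ge0// lerXn2r ?nnegrE ?(le_trans z0).
    by rewrite -[K.+1%:R]natr1; lra.
  - have -> : (fun t => h t * (S t + z j t)) = (fun t => h t * S t + h t * z j t).
      by apply/funext => t; ring.
    by rewrite (linbD linnu); try bnd; rewrite -natr1; lra.
(* For [n * n] summands, [2 * n * S <= n ^+ 2 + S ^+ 2] weighted by [h] would give [2 * n ^+ 3 * p
   <= n ^+ 2 * (3 + C ^+ 2) < n ^+ 3 * p]. *)
pose n := (Num.truncn ((3 + C ^+ 2) / p)).+1.
have np : 3 + C ^+ 2 < n%:R * p by rewrite -ltr_pdivrMr// truncnS_gt.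
have n0 : 0 < n%:R :> R by [].
have [S [bS _ S2 S1]] := build (n * n)%N.
have bS2 : bnd (fun t => S t ^+ 2) by under eq_fun do rewrite expr2; bnd.
have : 2 * n%:R * nu (fun t => h t * S t) <= n%:R ^+ 2 + nu (fun t => h t * S t ^+ 2).
  rewrite -[_ ^+ 2]mulr1 -nu1 -(posfun_cst pnu) -(linbD linnu); try bnd.
  rewrite nu1 -(linbZ linnu); try bnd.
  apply: (posfun_le pnu) => [||t]; try by bnd.
  have /andP[h0 h1] := h01 t.
  have : 0 <= h t * (S t - n%:R) ^+ 2 by rewrite mulr_ge0 ?sqr_ge0.
  have : 0 <= (1 - h t) * n%:R ^+ 2 by rewrite mulr_ge0 ?sqr_ge0 ?subr_ge0.
  lra.
move: S1 S2; rewrite natrM => S1 S2 h1.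
have h2 : 2 * n%:R * (n%:R * n%:R * p) <= n%:R ^+ 2 + n%:R * n%:R * (2 + C ^+ 2).
  apply: le_trans (le_trans h1 _); first by rewrite ler_wpM2l// mulr_ge0// ltW.
  by rewrite lerD2l.
have h3 : n%:R * n%:R * (3 + C ^+ 2) < n%:R * n%:R * (n%:R * p).
  by rewrite ltr_pM2l// mulr_gt0.
have h4 : 0 < n%:R * n%:R * (n%:R * p) by rewrite !mulr_gt0.
lra.
Unshelve. all: end_near. Qed.

End UltraDominatedConvergence.

(** * Independence from the failure of limit theorems *)

Section PointwiseLimits.
Context {R : realType} {X : uniformType}.
Hypothesis cX : compact [set: X].

Lemma open_sublevel (f : X -> R) a : continuous f -> open [set u | f u < a].
Proof. by move=> cf; apply: (@open_comp _ _ f [set v | v < a]) => //; exact: open_lt. Qed.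

Lemma open_superlevel (f : X -> R) a : continuous f -> open [set u | a < f u].
Proof. by move=> cf; apply: (@open_comp _ _ f [set v | a < v]) => //; exact: open_gt. Qed.

Lemma closed_superlevel (f : X -> R) a : continuous f -> closed [set u | a <= f u].
Proof. by move=> cf; apply: (@closed_comp _ _ f [set v | a <= v]) => //; exact: closed_ge. Qed.

Section Support.
Variables (G : (X -> R) -> R) (pG : posfun G).

Definition support_of : set X :=
  [set t | forall O, open O -> O t -> 0 < G (\1_O)].

Let bnd_indic (A : set X) : bnd (\1_A : X -> R).
Proof. by exists 1 => t; rewrite indicE ger0_norm// lern1 leq_b1. Qed.

(** Compactness replaces countable additivity: the sets whose complement in [K] is null form a
    proper filter, and a cluster point of it lies in [K] and has only neighbourhoods of positive
    mass. *)
Lemma closed_meets_support (K : set X) : closed K -> 0 < G (\1_K) ->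
  K `&` support_of !=set0.
Proof.
move=> clK GK.
pose F := [set A : set X | G (\1_(K `\` A)) <= 0].
have indic_le (A B : set X) t : A `<=` B -> \1_A t <= \1_B t :> R.
  move=> AB; rewrite !indicE ler_nat; case: (boolP (t \in A)) => // /set_mem /AB Bt.
  by rewrite mem_set.
have FF : ProperFilter F.
  apply: Build_ProperFilter_ex.
    move=> A FA; apply: contrapT => /set0P/negP/negPn/eqP A0.
    by move: FA; rewrite /F/= A0 setD0 leNgt GK.
  split.
  - by rewrite /F/= setDT indic0 (linb0 pG.1).
  - move=> A B FA FB; rewrite /F/=.
    have := lerD FA FB; rewrite addr0 -(linbD pG.1)//; apply: le_trans.
    apply: (posfun_le pG) => //; first by bnd.
    move=> t; rewrite !indicE -natrD ler_nat.
    case: (boolP (t \in K `\` (A `&` B))) => // /set_mem[Kt /not_andP[nA|nB]].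
      by rewrite (mem_set (_ : (K `\` A) t))// leq_addr.
    by rewrite (mem_set (_ : (K `\` B) t))// leq_addl.
  - move=> A B AB FA; apply: le_trans FA.
    by apply: (posfun_le pG) => // t; apply: indic_le => u [Ku nB]; split => // /AB.
have FK : F K by rewrite /F/= setDv indic0 (linb0 pG.1).
have cK : compact K by exact: subclosed_compact clK cX _.
have [t [Kt clt]] := cK F FF FK.
exists t; split => // O oO Ot; rewrite ltNge; apply/negP => GO.
have FO : F (~` O).
  apply: le_trans GO; apply: (posfun_le pG) => // u.
  by apply: indic_le => v [_ /contrapT].
by have [u []] := clt _ _ FO (open_nbhs_nbhs (conj oO Ot)).
Qed.

End Support.

(** Dominated convergence along an ultrafilter, in contrapositive form. The excess of [g j] over
    [c + delta] defines in the limit a functional [G] supported in [Y]. On an open set meeting the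
    support, [g j] is below [a] at a support point by convergence, and above [b] at another one by
    [ultra_correlation], for most [j]; so the tree of open sets can be grown. *)
Lemma independent_of_limit_lt (J : Type) (U : set_system J) (g : J -> X -> R)
    (C c delta : R) (Y : set X) (nu : (X -> R) -> R) :
  UltraFilter U -> (forall j, continuous (g j)) -> (forall j t, `|g j t| <= C) ->
  posfun nu -> nu (fun=> 1) = 1 -> closed Y ->
  (forall f, bnd f -> (forall t, Y t -> f t = 0) -> nu f = 0) ->
  (forall t, Y t -> (g^~ t) @ U --> c) ->
  0 < delta -> (forall j, c + 2 * delta <= nu (g j)) ->
  exists (al : nat -> J) (a b : R), a < b /\ independent (g \o al) a b.
Proof.
move=> UU cg gC pnu nu1 clY nuY gc d0 nug.
have linnu := pnu.1.
have bg j : bnd (g j) by exists C.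
pose z j t : R := Num.max 0 (g j t - (c + delta)).
pose C' : R := `|C| + `|c + delta|.
have zC j t : 0 <= z j t <= C'.
  rewrite /z le_max lexx/= ge_max addr_ge0//=.
  have := gC j t; rewrite /C' ler_norml => /andP[_ h].
  have := ler_norm C; have := ler_norm (- (c + delta)); rewrite normrN; lra.
have bz j : bnd (z j).
  by exists C' => t; have /andP[z0 z1] := zC j t; rewrite ger0_norm.
have nuz j : delta <= nu (z j).
  have : nu (fun t => g j t - (c + delta)) <= nu (z j).
    apply: (posfun_le pnu) => [||t]; try by bnd.
    by rewrite /z le_max lexx orbT.
  apply: le_trans; rewrite (linbB linnu); try bnd.
  by rewrite (posfun_cst pnu) nu1; have := nug j; lra.
pose G (h : X -> R) : R := lim ((fun j => nu (fun t => h t * z j t)) @ U).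
have bGs h : bnd h -> bnd (fun j => nu (fun t => h t * z j t)).
  move=> [D hD]; exists (D * C' * nu (fun=> 1)) => j.
  apply: (posfun_norm_le pnu) => t; rewrite normrM ler_pM//.
  by have /andP[z0 z1] := zC j t; rewrite ger0_norm.
have pG : posfun G.
  apply: ulim_posfun => // j; split.
    move=> a f h bf bh; rewrite -linnu; try bnd.
    by congr nu; apply/funext => t; ring.
  move=> f bf f0; apply: pnu.2 => [|t]; first by bnd.
  by rewrite mulr_ge0//; have /andP[] := zC j t.
have b1 (A : set X) : bnd (\1_A : X -> R).
  by exists 1 => t; rewrite indicE ger0_norm// lern1 leq_b1.
pose D := support_of G.
(* As [nu] is carried by the closed set [Y], the complement of [Y] is open and [G]-null. *)
have DY : D `<=` Y.
  move=> t Dt; apply: contrapT => nYt.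
  have := Dt (~` Y) (closed_openC clY) nYt.
  rewrite /G (_ : (fun j => _) = fun=> 0) ?lim_cst ?ltxx//.
  apply/funext => j; apply: nuY; first by bnd.
  by move=> u Yu; rewrite indicE memNset ?mul0r//; apply.
(* Both levels lie strictly between [c] and [c + delta], so the strict, open conditions hold with
   room to spare. *)
pose a := c + delta / 3; pose b := c + 2 * delta / 3.
have ab : a < b by rewrite /a /b; lra.
pose good := [set O : set X | open O /\ O `&` D !=set0].
suff [al ind] : exists al : nat -> J, independent (g \o al) a b by exists al, a, b.
apply: (@independent_of_tree _ _ _ U _ g a b good).
- exists setT; split; first exact: openT.
  rewrite setTI.
  have [||t [_ Dt]] := @closed_meets_support G pG setT; [exact: closedT| |by exists t].
  apply: (lt_le_trans d0); apply: ulim_ge; first exact: bGs.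
  near=> j; apply: (le_trans (nuz j)); apply: (posfun_le pnu) => [||t]; try by bnd.
  by rewrite indicT mul1r.
- by move=> A [_ [t [At _]]]; exists t.
- move=> O [oO [t [Ot Dt]]].
  have near_a : \forall j \near U, g j t < a.
    have /cvgr_lt := gc t (DY _ Dt); apply; rewrite /a; lra.
  (* A neighbourhood with closure inside [O]: support points are found in closed sets, and this one
     must fall in [O]. *)
  have [B tB BO] := @uniform_regular X t O (open_nbhs_nbhs (conj oO Ot)).
  pose h : X -> R := \1_(B°).
  have Gh : 0 < G h by apply: Dt; [exact: open_interior|exact: nbhs_singleton (nbhs_interior tB)].
  have near_p : \forall j \near U, G h / 2 <= nu (fun t => h t * z j t).
    have : G h / 2 < G h by lra.
    by move/(ulim_gt (bGs h (b1 _))); apply: filterS => j /ltW.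
  have h01 u : 0 <= h u <= 1 by rewrite /h indicE ler0n lern1 leq_b1.
  have Gh2 : 0 < G h / 2 by lra.
  have near_b := ultra_correlation UU pnu nu1 h01 zC Gh2 near_p.
  near=> j; split.
    exists (O `&` [set u | g j u < a]) => [|u [Ou /ltW]//].
    split; first by apply: openI => //; exact: open_sublevel.
    by exists t; split => //; split => //=; near: j.
  have : 0 < G (fun t => h t * z j t) by near: j; exact: near_b.
  move=> Ghz.
  pose K := closure B `&` [set u | c + delta <= g j u].
  have clK : closed K.
    apply: closedI; first exact: closed_closure.
    exact: closed_superlevel.
  have GK : 0 < G (\1_K).
    have hzK u : h u * z j u <= C' * \1_K u.
      have /andP[z0 z1] := zC j u.
      rewrite /h !indicE; case: (boolP (u \in (B° : set X))) => [/set_mem Bu|_]; last first.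
        by rewrite mul0r mulr_ge0// (le_trans z0).
      have [gu|gu] := leP (c + delta) (g j u).
        rewrite (mem_set (_ : K u)) ?mul1r ?mulr1//; split => //.
        exact: (subset_closure (interior_subset Bu)).
      have -> : z j u = 0 by rewrite /z max_l//; lra.
      by rewrite mulr0 mulr_ge0// (le_trans z0 z1).
    have C'0 : 0 <= C' by rewrite addr_ge0.
    have : 0 < C' * G (\1_K).
      apply: lt_le_trans Ghz _; rewrite -(linbZ pG.1)//.
      have bh : bnd h := b1 _.
      apply: (posfun_le pG) => //; bnd.
    by move=> h2; rewrite ltNge; apply/negP => h3; have := mulr_ge0_le0 C'0 h3; lra.
  have [u [[Bu gu] Du]] := closed_meets_support pG clK GK.
  exists (O `&` [set u | b < g j u]) => [|v [Ov /ltW]//].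
  split; first by apply: openI => //; exact: open_superlevel.
  exists u; split => //; split; first exact: BO.
  by move: gu => /=; apply: lt_le_trans; rewrite /b; lra.
Unshelve. all: end_near. Qed.

(* A pointwise limit taking two different values, each on a dense subset of
   [M], forces independence. *)
Lemma independent_of_dense_values (J : Type) (U : set_system J) (g : J -> X -> R)
    (M : set X) (f : X -> R) (c1 c2 : R) : ProperFilter U ->
  (forall j, continuous (g j)) -> (forall t, M t -> (g^~ t) @ U --> f t) ->
  M !=set0 -> c1 < c2 ->
  (forall O, open O -> O `&` M !=set0 -> O `&` M `&` f @^-1` [set c1] !=set0) ->
  (forall O, open O -> O `&` M !=set0 -> O `&` M `&` f @^-1` [set c2] !=set0) ->
  exists (al : nat -> J) (a b : R), a < b /\ independent (g \o al) a b.
Proof.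
move=> FU cg gf [t0 Mt0] c12 d1 d2.
pose a := c1 + (c2 - c1) / 3; pose b := c1 + 2 * (c2 - c1) / 3.
have ab : a < b by rewrite /a /b; lra.
suff [al ind] : exists al : nat -> J, independent (g \o al) a b by exists al, a, b.
apply: (@independent_of_tree _ _ _ U _ g a b [set O | open O /\ O `&` M !=set0]).
- by exists setT; split; [exact: openT|exists t0].
- by move=> A [_ [t [At _]]]; exists t.
- move=> O [oO OM].
  have [t1 [[Ot1 Mt1] /= ft1]] := d1 O oO OM.
  have [t2 [[Ot2 Mt2] /= ft2]] := d2 O oO OM.
  have near1 : \forall j \near U, g j t1 < a.
    have /cvgr_lt := gf t1 Mt1; apply; rewrite ft1 /a; lra.
  have near2 : \forall j \near U, b < g j t2.
    have /cvgr_gt := gf t2 Mt2; apply; rewrite ft2 /b; lra.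
  near=> j; split.
    exists (O `&` [set u | g j u < a]) => [|u [Ou /ltW]//].
    split; first by apply: openI => //; exact: open_sublevel.
    by exists t1; split => //; split => //=; near: j.
  exists (O `&` [set u | b < g j u]) => [|v [Ov /ltW]//].
  split; first by apply: openI => //; exact: open_superlevel.
  by exists t2; split => //; split => //=; near: j.
Unshelve. all: end_near. Qed.

End PointwiseLimits.

(** * Minimal sets, idempotents and proximality *)

Section MinimalClosed.
Context {X : topologicalType}.
Hypothesis cX : compact [set: X].

(** Zorn's lemma for reverse inclusion. [P] is abstract in order to cover both subsemigroups and
    sets stable under composition with [phi]. *)
Lemma minimal_closed (P : set (set X)) (A0 : set X) :
  (forall F : set (set X), F `<=` P -> P (\bigcap_(A in F) A)) ->
  closed A0 -> A0 !=set0 -> P A0 ->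
  exists A, [/\ A `<=` A0, closed A, A !=set0, P A &
    forall B, B `<=` A -> closed B -> B !=set0 -> P B -> B = A].
Proof.
move=> Pcap clA0 neA0 PA0.
pose good A := [/\ A `<=` A0, closed A, A !=set0 & P A].
have gA0 : good A0 by split.
pose T := {A : set X | good A}.
pose Rel (s t : T) := `[< sval t `<=` sval s >].
have [||||[A [sA clA neA PA]] maxA] := @Zorn T Rel.
- by move=> t; exact/asboolP.
- by move=> r s t /asboolP rs /asboolP st; apply/asboolP; exact: subset_trans st rs.
- move=> [A gA] [B gB] /asboolP/= AB /asboolP/= BA; apply: eq_exist => /=.
  exact/seteqP.
- move=> F totF; have [[s0 Fs0]|noF] := pselect (F !=set0); last first.
    exists (exist _ A0 gA0) => s Fs; exfalso; apply: noF; by exists s.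
  pose I := \bigcap_(A in [set sval s | s in F]) A.
  have sub s : F s -> I `<=` sval s by move=> Fs t It; apply: It; exists s.
  have gI : good I.
    split.
    - by apply: subset_trans (sub _ Fs0) _; case: (svalP s0).
    - by apply: closed_bigI => _ [s _ <-]; case: (svalP s).
    (* The chain generates a proper filter; by compactness it has a cluster point, which lies in
       every member. *)
    - pose G := [set S : set X | exists2 s, F s & sval s `<=` S].
      have PG : ProperFilter G.
        apply: Build_ProperFilter_ex.
          move=> S [s _ sS]; have [_ _ [t st] _] := svalP s.
          by exists t; exact: sS.
        split.
        + by exists s0.
        + move=> S S' [s Fs sS] [s' Fs' sS'].
          have [/asboolP ss'|/asboolP s's] := totF _ _ Fs Fs'.
            by exists s' => // t s't; split; [apply/sS/ss'|apply: sS'].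
          by exists s => // t st; split; [apply: sS|apply/sS'/s's].
        + by move=> S S' SS' [s Fs sS]; exists s => //; exact: subset_trans SS'.
      have [t [_ clt]] := cX PG filterT.
      exists t => _ [s Fs <-]; have [_ cls _ _] := svalP s.
      by apply: cls => B tB; apply: clt => //; exists s.
    - by apply: Pcap => _ [s _ <-]; case: (svalP s).
  by exists (exist _ I gI) => s Fs; apply/asboolP; exact: sub.
exists A; split => // B BA clB neB PB.
have gB : good B by split => //; exact: (subset_trans BA sA).
by have /(congr1 sval) := maxA (exist _ B gB) (asboolT BA).
Qed.

End MinimalClosed.

(** * The enveloping semigroup and proximality *)

Section Dynamics.
Context {R : realType} {Omega : metricType R}.
Hypothesis cO : compact [set: Omega].
Local Notation E := {ptws Omega -> Omega}.

Lemma compact_ptws : compact [set: E].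
Proof.
have := @tychonoff Omega (fun=> Omega) (fun=> setT) (fun=> cO).
by congr compact; apply/seteqP; split.
Qed.

Lemma hausdorff_ptws : hausdorff_space E.
Proof. by apply: (@hausdorff_product Omega (fun=> Omega)) => _; exact: metric_hausdorff. Qed.

Lemma eval_continuous (w : Omega) : continuous (fun p : E => p w).
Proof. exact: (@proj_continuous Omega (fun=> Omega) w). Qed.

Lemma ptws_continuous (T : topologicalType) (F : T -> E) :
  (forall w, continuous (fun s => F s w)) -> continuous F.
Proof.
by move=> h s; apply/(@pointwise_cvgP Omega Omega _ (F s)) => w; exact: h.
Qed.

(** For pointwise convergence, composition is continuous in the left factor with any right factor,
    whereas continuity in the right factor is obtained below for a continuous left factor. *)
Lemma compr_continuous (q : E) : continuous (fun p : E => (p \o q : E)).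
Proof. by apply: ptws_continuous => w; exact: eval_continuous. Qed.

Lemma compl_continuous (f : Omega -> Omega) : continuous f ->
  continuous (fun p : E => (f \o p : E)).
Proof.
move=> cf; apply: ptws_continuous => w p.
apply: (@continuous_comp _ _ _ (fun p : E => p w) f); first exact: eval_continuous.
exact: cf.
Qed.

(* Ellis-Numakura *)
Lemma exists_idempotent (S : set E) : closed S -> S !=set0 ->
  (forall p q, S p -> S q -> S (p \o q)) -> exists2 u, S u & u \o u = u.
Proof.
move=> clS neS compS.
have [|A [AS clA [p Ap] /= compA minA]] := @minimal_closed E compact_ptws
    [set A : set E | forall p q, A p -> A q -> A (p \o q)] S _ clS neS compS.
  by move=> F FP p q Fp Fq A FA; apply: (FP _ FA); [apply: Fp|apply: Fq].
exists p; first exact: AS.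
(* By minimality [A \o p] is all of [A], so [q \o p = p] for some [q] in [A]. *)
have Ap_eq : (fun q : E => (q \o p : E)) @` A = A.
  apply: minA.
  - by move=> _ [q Aq <-]; apply: compA.
  - apply: compact_closed; first exact: hausdorff_ptws.
    apply: continuous_compact; last by apply: subclosed_compact clA compact_ptws _.
    exact/continuous_subspaceT/compr_continuous.
  - by exists (p \o p); exists p.
  - move=> _ _ [q Aq <-] [q' Aq' <-]; exists (q \o p \o q') => //.
    by apply: (compA) => //; apply: (compA).
have [q Aq qp] : ((fun q : E => (q \o p : E)) @` A) p by rewrite Ap_eq.
(* The stabilizer of [p] is a nonempty closed subsemigroup of [A], hence equals [A] and contains [p]
   itself. *)
have N_eq : A `&` [set q : E | (q \o p : E) = p] = A.
  apply: minA.
  - exact: subIsetl.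
  - apply: closedI => //.
    apply: (@closed_comp _ _ (fun q : E => (q \o p : E)) [set p]).
      by move=> ? _; exact: compr_continuous.
    exact/accessible_closed_set1/hausdorff_accessible/hausdorff_ptws.
  - by exists q.
  - move=> r r' [Ar rp] [Ar' rp']; split; first exact: compA.
    by rewrite /= -[LHS]/(r \o (r' \o p)) rp'.
by have [] : (A `&` [set q : E | (q \o p : E) = p]) p by rewrite N_eq.
Qed.

Variable phi : continuousType Omega Omega.
Local Notation EE := (enveloping_semigroup phi : set E).

Let cphi : continuous phi. Proof. exact: cts_fun. Qed.

Lemma continuous_iter n : continuous (iter n phi).
Proof.
elim: n => [|n IH] t; first exact: cvg_id.
by apply: (@continuous_comp _ _ _ (iter n phi) phi); [exact: IH|exact: cphi].
Qed.

Lemma closed_env : closed EE. Proof. exact: closed_closure. Qed.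

Lemma compact_env : compact EE.
Proof. exact: subclosed_compact closed_env compact_ptws _. Qed.

Lemma iter_env n : EE (iter n phi : E).
Proof. by apply: subset_closure; exists n. Qed.

Lemma env_sub (S : set E) : closed S -> (forall n, S (iter n phi : E)) -> EE `<=` S.
Proof.
move=> clS Sn; rewrite /enveloping_semigroup.
have : closure [set p : E | exists n : nat, p = iter n phi] `<=` closure S.
  by apply: closureS => _ [n ->].
by rewrite -((closure_id S).1 clS).
Qed.

Lemma iter_comp_env n p : EE p -> EE (iter n phi \o p).
Proof.
move: p; apply: env_sub.
  apply: (@closed_comp _ _ (fun p : E => (iter n phi \o p : E)) EE) => [p _|].
    exact/compl_continuous/continuous_iter.
  exact: closed_env.
move=> m; rewrite /= (_ : _ \o _ = iter (n + m) phi); first exact: iter_env.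
by apply/funext => t; rewrite /= iterD.
Qed.

(** The right factor is fixed, and the left one is approximated by iterates, for which
    [iter_comp_env] uses continuity. *)
Lemma comp_env p q : EE p -> EE q -> EE (p \o q).
Proof.
move=> + Eq; move: p; apply: env_sub.
  apply: (@closed_comp _ _ (fun p : E => (p \o q : E)) EE) => [p _|].
    exact: compr_continuous.
  exact: closed_env.
by move=> n; exact: iter_comp_env.
Qed.

Lemma env_closed_invariant (M : set Omega) w p :
  closed M -> (forall n, M (iter n phi w)) -> EE p -> M (p w).
Proof.
move=> clM Mw; move: p; apply: (@env_sub [set p : E | M (p w)]) => //.
by apply: (@closed_comp _ _ (fun p : E => p w) M) => // p _; exact: eval_continuous.
Qed.

Lemma invariant_iter (M : set Omega) w :
  (forall t, M t -> M (phi t)) -> M w -> forall n, M (iter n phi w).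
Proof. by move=> Mphi Mw; elim=> // n IH; exact: Mphi. Qed.

Lemma proximalP w1 w2 : proximal phi w1 w2 <->
  forall e : R, 0 < e -> exists n, mdist (iter n phi w1) (iter n phi w2) < e.
Proof.
rewrite /proximal; set S := [set _ | _ in _].
have hS : has_inf S.
  split; first by exists (mdist (iter 0 phi w1) (iter 0 phi w2)); exists 0%N.
  by exists 0 => _ [n _ <-]; exact: mdist_ge0.
split => [infS e e0|H].
  have [_ [n _ <-]] := inf_adherent e0 hS.
  by rewrite infS add0r => h; exists n.
apply/eqP; rewrite eq_le; apply/andP; split.
  apply/ler_addgt0Pl => e e0; rewrite addr0; have [n /ltW h] := H e e0.
  by apply: le_trans h; apply: ge_inf; [case: hS|exists n].
by apply: lb_le_inf; [case: hS|move=> _ [n _ <-]; exact: mdist_ge0].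
Qed.

Lemma near_ball_eval (p : E) w (e : R) : 0 < e ->
  \forall q \near p, mdist (p w) (q w) < e.
Proof.
move=> e0; have : nbhs (p w) (ball (p w) e) by exact: nbhsx_ballx.
move/(@eval_continuous w p); apply: (@filterS _ (nbhs (p : E)) _) => q /=.
by rewrite ballEmdist.
Qed.

(* Auslander-Ellis *)
Lemma exists_proximal (M : set Omega) (w : Omega) (p : E) :
  closed M -> (forall t, M t -> M (phi t)) -> EE p -> M (p w) ->
  exists2 m, M m & proximal phi w m.
Proof.
move=> clM Mphi Ep Mpw.
pose S : set E := EE `&` [set q : E | M (q w)].
have [||q q' [Eq Mq] [Eq' Mq']|u [Eu Muw] uu] := @exists_idempotent S.
- apply: closedI; first exact: closed_env.
  by apply: (@closed_comp _ _ (fun p : E => p w) M) => // q _; exact: eval_continuous.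
- by exists p.
- split; first exact: comp_env.
  by apply: (@env_closed_invariant M (q' w) q) => //; exact: invariant_iter.
exists (u w) => //; apply/proximalP => e e0.
have e20 : 0 < e / 2 by rewrite divr_gt0.
(* An iterate approximating [u] at both [w] and [u w] brings the two orbits near [u w], because
   [u (u w) = u w]. *)
have nb : nbhs (u : E) [set q : E | mdist (u w) (q w) < e / 2 /\
    mdist (u (u w)) (q (u w)) < e / 2].
  by apply: filterI; exact: near_ball_eval.
have [q [[n qn] [h1 h2]]] := Eu _ nb.
move: h1 h2; rewrite {}qn => h1 h2.
exists n; rewrite (le_lt_trans (metric_triangle _ (u w) _))//.
rewrite [ltRHS](splitr e) ltrD//; first by rewrite metric_sym.
by move: h2; rewrite -[X in mdist X]/((u \o u) w) uu.
Qed.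

(** A cluster point of the orbit of [m], along times when the two orbits approach each other,
    belongs to both closed sets. *)
Lemma proximal_meet (M M' : set Omega) m m' :
  closed M -> (forall t, M t -> M (phi t)) -> M m ->
  closed M' -> (forall t, M' t -> M' (phi t)) -> M' m' ->
  proximal phi m m' -> M `&` M' !=set0.
Proof.
move=> clM Mphi Mm clM' M'phi M'm' /proximalP prox.
pose F := [set S : set Omega | exists2 e : R, 0 < e &
  forall n, mdist (iter n phi m) (iter n phi m') < e -> S (iter n phi m)].
have PF : ProperFilter F.
  apply: Build_ProperFilter_ex.
    by move=> S [e e0 eS]; have [n /eS] := prox e e0; exists (iter n phi m).
  split.
  - by exists 1.
  - move=> S S' [e e0 eS] [e' e'0 e'S']; exists (Num.min e e').
      by rewrite lt_min e0.
    by move=> n; rewrite lt_min => /andP[/eS ? /e'S' ?].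
  - by move=> S S' SS' [e e0 eS]; exists e => // n /eS/SS'.
have [t [_ clt]] := cO PF filterT.
have FM : F M by exists 1 => // n _; exact: invariant_iter.
exists t; split; first by apply: clM => B tB; exact: clt.
apply: clM' => B /nbhs_ballP[e /= e0 tB].
have e20 : 0 < e / 2 by rewrite divr_gt0.
have FS : F [set s | exists2 s', M' s' & mdist s s' < e / 2].
  by exists (e / 2) => // n h; exists (iter n phi m') => //; exact: invariant_iter.
have [s [[s' M's' ss'] ts]] := clt _ _ FS (nbhsx_ballx t _ e20).
exists s'; split => //; apply: tB; rewrite ballEmdist /=.
rewrite (le_lt_trans (metric_triangle _ s _))// [ltRHS](splitr e) ltrD//.
by move: ts; rewrite ballEmdist.
Qed.

End Dynamics.

(** * Convergence of Cesaro means *)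

Section UltrafilterCriteria.
Context {R : realType} {J : Type}.

(** If convergence failed, [F] restricted to the indices far from [c] would be proper and refine to
    an ultrafilter with a different limit. *)
Lemma cvg_of_ultra (F : set_system J) (u : J -> R) (c : R) : ProperFilter F ->
  bnd u -> (forall U, UltraFilter U -> F `<=` U -> lim (u @ U) = c) ->
  u @ F --> c.
Proof.
move=> PF bu uc; apply/cvgrPdist_lt => e e0.
apply: contrapT => nF.
pose A := [set j | ~ (`|c - u j| < e)].
have PA : ProperFilter (within A F).
  apply: Build_ProperFilter_ex.
  move=> S FS; apply: contrapT => nS; apply: nF.
  apply: (@filterS _ F _ _ _ _ FS) => j jS; apply: contrapT => Aj.
  by apply: nS; exists j; exact: jS.
have [U [UU FU]] := ultraFilterLemma PA.
have FU' : F `<=` U by move=> S FS; apply: FU; apply: (@filterS _ F _ _ _ _ FS).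
have UA : U A by apply: FU; exact: withinT.
have := @ulim_cvg _ _ U UU _ bu; rewrite (uc U UU FU') => /cvgrPdist_lt/(_ _ e0) Ue.
by have [j [Aj /Aj]] := filter_ex (filterI UA Ue).
Qed.

Lemma ulim_eq (U : set_system J) (u v : J -> R) : UltraFilter U -> bnd u -> bnd v ->
  (fun j => u j - v j) @ U --> 0 -> lim (u @ U) = lim (v @ U).
Proof.
move=> UU bu bv uv; apply/eqP; rewrite -subr_eq0; apply/eqP.
rewrite -(ulimP uv); apply/esym/ulimP.
by apply: cvgB; exact: ulim_cvg.
Qed.

End UltrafilterCriteria.

(** The difference telescopes to two boundary terms over [n.+1]. This is what makes limits of orbit
    averages invariant. *)
Lemma cesaro_shift (R : realType) (a : nat -> R) (D : R) : (forall i, `|a i| <= D) ->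
  (fun n : nat => n.+1%:R^-1 * (\sum_(i < n.+1) a i.+1) -
                  n.+1%:R^-1 * (\sum_(i < n.+1) a i)) @ \oo --> 0.
Proof.
move=> aD.
have tel n : n.+1%:R^-1 * (\sum_(i < n.+1) a i.+1) - n.+1%:R^-1 * (\sum_(i < n.+1) a i) =
    (a n.+1 - a 0%N) * n.+1%:R^-1.
  rewrite -mulrBr -sumrB mulrC; congr (_ * _).
  by rewrite -(big_mkord xpredT (fun i => a i.+1 - a i)) telescope_sumr.
under eq_fun do rewrite tel.
have bd n : `|(a n.+1 - a 0%N) * n.+1%:R^-1| <= 2 * D * n.+1%:R^-1.
  rewrite normrM [X in _ * X]ger0_norm// ler_wpM2r//.
  by rewrite (le_trans (ler_normB _ _))// mulrDl mul1r lerD.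
apply/norm_cvg0P; apply: (@squeeze_cvgr _ _ _ _ (fun=> 0) (fun n => 2 * D * n.+1%:R^-1)).
- by near=> n; rewrite normr_ge0 bd.
- exact: cvg_cst.
- rewrite -[X in _ --> X](mulr0 (2 * D)); apply: cvgMr; exact: cvg_harmonic.
Unshelve. all: end_near. Qed.

(** * Orbit averages in the absence of independent block means *)

Section Birkhoff.
Context {R : realType} {Omega : metricType R}.
Hypothesis cO : compact [set: Omega].
Variable phi : continuousType Omega Omega.
Variables (x : Omega -> R) (cx : continuous x).
Local Notation E := {ptws Omega -> Omega}.
Local Notation EE := (enveloping_semigroup phi : set E).

Definition orbit_seq (i : nat) (t : Omega) := x (iter i phi t).

Hypothesis dep : forall (mn : nat -> nat * nat) (a b : R), a < b ->
  ~ independent (fun k => block_mean orbit_seq (mn k)) a b.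
Hypothesis prox_eqv : Equivalence (proximal phi).

Lemma bnd_continuous : bnd x.
Proof.
have /compact_bounded[M [Mreal bM]] : compact (x @` [set: Omega]).
  by apply: continuous_compact => //; exact: continuous_subspaceT.
exists (M + 1) => t; apply: bM; first by rewrite ltrDl.
by exists t.
Qed.

Lemma continuous_block_mean mn : continuous (block_mean orbit_seq mn).
Proof.
have cS n : continuous (fun t => \sum_(i < n) orbit_seq (mn.2.+1 + i)%N t).
  elim: n => [|n IH] t.
    by under eq_fun do rewrite big_ord0; exact: cvg_cst.
  under eq_fun do rewrite big_ord_recr; apply: cvgD; first exact: IH.
  by apply: (@continuous_comp _ _ _ (iter _ phi) x); [exact: continuous_iter|exact: cx].
by move=> t; apply: cvgMr; exact: cS.
Qed.

Let bm m n t := block_mean orbit_seq (m, n) t.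

Let bm_shift m n t : bm m n t = bm m 0 (iter n phi t).
Proof.
rewrite /bm /block_mean; congr (_ * _); apply: eq_bigr => i _ /=.
by rewrite /orbit_seq -iterD (_ : n.+1 + i = 0.+1 + i + n)%N//; lia.
Qed.

Let bm_bnd : exists C : R, forall mn t, `|block_mean orbit_seq mn t| <= C.
Proof.
have [C xC] := bnd_continuous; exists C => mn t.
by apply: (@block_mean_le R Omega orbit_seq C) => i u; exact: xC.
Qed.

Section Generic.
Variables (U : set_system nat) (UU : UltraFilter U) (Uoo : \oo `<=` U).

Definition ultra_mean t := lim ((fun m => block_mean orbit_seq (m, 0%N) t) @ U).
Local Notation f := ultra_mean.

Let bnd_bm0 t : bnd (fun m : nat => block_mean orbit_seq (m, 0%N) t).
Proof. by have [C bC] := bm_bnd; exists C => m; exact: bC. Qed.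

Lemma ultra_mean_phi t : f (phi t) = f t.
Proof.
apply: ulim_eq; [exact: bnd_bm0|exact: bnd_bm0|].
have [C xC] := bnd_continuous.
have := @cesaro_shift R (fun i => x (iter i.+1 phi t)) C (fun i => xC _).
have -> : (fun m : nat => m.+1%:R^-1 * (\sum_(i < m.+1) x (iter i.+2 phi t)) -
      m.+1%:R^-1 * (\sum_(i < m.+1) x (iter i.+1 phi t))) =
    (fun m => block_mean orbit_seq (m, 0%N) (phi t) - block_mean orbit_seq (m, 0%N) t).
  apply/funext => m; rewrite /block_mean /=; congr (_ * _ - _).
  by apply: eq_bigr => i _; rewrite /orbit_seq -iterSr.
by apply: cvg_trans; exact: (cvg_app _ Uoo).
Qed.

Lemma ultra_mean_iter n t : f (iter n phi t) = f t.
Proof. by elim: n => //= n <-; exact: ultra_mean_phi. Qed.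

(** By invariance, each value taken on [M] is constant along an orbit, and orbits are dense in [M];
    two distinct values would give independent block means. *)
Lemma ultra_mean_const (M : set Omega) :
  (forall t, M t -> M (phi t)) ->
  (forall m t O, M m -> M t -> open O -> O t -> exists k, O (iter k phi m)) ->
  forall s t, M s -> M t -> f s = f t.
Proof.
move=> Mphi dense s t.
wlog st : s t / f s < f t.
  move=> H Ms Mt; have [st|st|//] := ltgtP (f s) (f t); first exact: H.
  by apply/esym/H.
move=> Ms Mt; exfalso.
have hit m : M m -> forall O, open O -> O `&` M !=set0 ->
    O `&` M `&` f @^-1` [set f m] !=set0.
  move=> Mm O oO [u [Ou Mu]]; have [k Ok] := dense m u O Mm Mu oO Ou.
  exists (iter k phi m); split; last exact: ultra_mean_iter.
  by split => //; exact: invariant_iter.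
have [||al [a [b [ab ind]]]] := @independent_of_dense_values R Omega nat U
   (fun m => block_mean orbit_seq (m, 0%N)) M f (f s) (f t) _
   (fun m => @continuous_block_mean (m, 0%N)) _ _ st (hit s Ms) (hit t Mt).
- by move=> u _; exact: ulim_cvg.
- by exists s.
- exact: (dep (mn := fun k => (al k, 0%N)) ab ind).
Qed.

End Generic.

(** Block means starting at [n] are block means at 0 composed with [phi^n]. Letting [phi^n] approach
    an element [p0] of a minimal set moves every point of the orbit closure into a minimal set,
    where the limit is constant. *)
Lemma exists_block_means_cvg (w0 : Omega) :
  exists (V : set_system (nat * nat)) (c : R), UltraFilter V /\
    forall p : E, EE p -> (fun mn => block_mean orbit_seq mn (p w0)) @ V --> c.
Proof.
have [U [UU Uoo]] := @ultraFilterLemma nat \oo _.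
(* [L] is minimal for [p |-> phi \o p] on the enveloping semigroup, so its values at [w] form a
   minimal set [M w] in the orbit closure of [w]. *)
have [||||L [LE clL [p0 Lp0] Linv Lmin]] := @minimal_closed E (compact_ptws cO)
   [set A : set E | forall p, A p -> A (phi \o p)] EE.
- by move=> F FP p Fp A FA; apply: (FP _ FA); exact: Fp.
- exact: closed_env.
- by exists (iter 0 phi); exact: iter_env.
- by move=> p; exact: (@iter_comp_env _ _ phi 1).
pose M (w : Omega) := [set p w | p in L].
have Mphi w t : M w t -> M w (phi t).
  by move=> [p Lp <-]; exists (phi \o p) => //; exact: Linv.
have clM w : closed (M w).
  apply: compact_closed; first exact: metric_hausdorff.
  apply: continuous_compact; last by apply: subclosed_compact clL (compact_ptws cO) _.
  exact/continuous_subspaceT/eval_continuous.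
have dense w m t O : M w m -> M w t -> open O -> O t -> exists k, O (iter k phi m).
  move=> [p Lp <-] [q Lq <-] oO Oqw.
  pose Z := closure [set iter k phi (p w) | k in [set: nat]].
  (* The elements of [L] sending [w] into the orbit closure [Z] of [p w] form a nonempty closed
     invariant set, hence all of [L]. *)
  have : L `&` [set r : E | Z (r w)] = L.
    apply: Lmin.
    - exact: subIsetl.
    - apply: closedI => //; apply: (@closed_comp _ _ (fun r : E => r w) Z).
        by move=> r _; exact: eval_continuous.
      exact: closed_closure.
    - by exists p; split => //; apply: subset_closure; exists 0%N.
    - move=> r [Lr Zr]; split; first exact: Linv.
      move=> B /(@cts_fun _ _ phi) Bphi; have [u [[k _ <-] Bu]] := Zr _ Bphi.
      by exists (iter k.+1 phi (p w)); split => //; exists k.+1.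
  move=> LZ; have [_ Zq] : (L `&` [set r : E | Z (r w)]) q by rewrite LZ.
  have [_ [[k _ <-] Ok]] := Zq _ (open_nbhs_nbhs (conj oO Oqw)).
  by exists k.
have fconst w s t : M w s -> M w t -> ultra_mean U s = ultra_mean U t.
  by apply: ultra_mean_const => //; [exact: Mphi|exact: dense].
pose c := ultra_mean U (p0 w0).
(* [w0] is proximal to some [m] in [M (p w0)] and to some [m'] in [M w0]. Transitivity makes [m] and
   [m'] proximal, so the two minimal sets meet and carry the same constant. *)
have fc p : EE p -> ultra_mean U (p0 (p w0)) = c.
  move=> Ep.
  have M1 : M (p w0) (p0 (p w0)) by exists p0.
  have M2 : M w0 (p0 w0) by exists p0.
  have [m Mm wm] := @exists_proximal _ _ cO phi (M (p w0)) w0 (p0 \o p)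
    (clM _) (Mphi _) (comp_env (LE _ Lp0) Ep) M1.
  have [m' Mm' wm'] := @exists_proximal _ _ cO phi (M w0) w0 p0
    (clM _) (Mphi _) (LE _ Lp0) M2.
  have mm' : proximal phi m m'.
    by apply: (Equivalence_Transitive m w0 m') => //; apply: Equivalence_Symmetric.
  have [z [Mz M'z]] := proximal_meet cO (clM _) (Mphi _) Mm (clM _) (Mphi _) Mm' mm'.
  by rewrite (fconst _ _ _ M1 Mz) /c (fconst _ _ _ M2 M'z).
(* The filter of an iterated limit: [phi^n] tends to [p0] for fixed [m], then [m] runs along [U]. *)
pose F := [set S : set (nat * nat) | \forall m \near U,
   \forall q \near p0, forall n, q = iter n phi -> S (m, n)].
have PF : ProperFilter F.
  apply: Build_ProperFilter_ex.
    move=> S FS; have [m mS] := @filter_ex _ U _ _ FS.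
    have [q []] := LE _ Lp0 [set q : E | forall n, q = iter n phi -> S (m, n)] mS.
    by move=> [n qn] /(_ n qn) Smn; exists (m, n).
  split.
  - by apply: (@filterE _ U) => m; apply: (@filterE _ (nbhs p0)).
  - move=> S S' FS FS'; apply: (@filterS2 _ U _ _ _ _ _ FS FS') => m.
    apply: (@filterS2 _ (nbhs p0)) => q h h' n qn.
    by split; [exact: h|exact: h'].
  - move=> S S' SS'; apply: (@filterS _ U) => m.
    by apply: (@filterS _ (nbhs p0)) => q h n qn; exact/SS'/h.
have [V [UV FV]] := ultraFilterLemma PF.
exists V, c; split => // p Ep.
apply/cvgrPdist_lt => e e0; apply: FV.
have e20 : 0 < e / 2 by rewrite divr_gt0.
have [C bC] := bm_bnd.
have : bnd (fun m : nat => block_mean orbit_seq (m, 0%N) (p0 (p w0))).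
  by exists C => m; exact: bC.
move=> /(@ulim_cvg _ _ U UU) /cvgrPdist_lt/(_ _ e20).
rewrite -/(ultra_mean U _) (fc p Ep); apply: filterS => m hm.
have cont : continuous (fun q : E => block_mean orbit_seq (m, 0%N) (q (p w0))).
  move=> q; apply: (@continuous_comp _ _ _ (fun q : E => q (p w0))).
    exact: eval_continuous.
  exact: continuous_block_mean.
have /cvgrPdist_lt/(_ _ e20) := cont p0.
apply: filterS => q hq n qn; rewrite -/(bm m n _) bm_shift.
move: hq; rewrite qn => hq.
rewrite -(subrKA (block_mean orbit_seq (m, 0%N) (p0 (p w0)))).
by rewrite (le_lt_trans (ler_normD _ _))// [ltRHS](splitr e) ltrD.
Unshelve. all: end_near. Qed.

(** Each limit functional [nu] of the orbit averages is invariant, hence gives all block means the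
    value [nu x]. These converge to [c] on the orbit closure, so [nu x] differing from [c] would
    force independence. *)
Lemma birkhoff_cvg (w0 : Omega) : exists c : R,
  (fun n => n.+1%:R^-1 * \sum_(i < n.+1) x (iter i phi w0)) @ \oo --> c.
Proof.
have [V [c [UV Vc]]] := exists_block_means_cvg w0.
exists c; have [C xC] := bnd_continuous.
pose av (n : nat) (h : Omega -> R) : R := n.+1%:R^-1 * \sum_(i < n.+1) h (iter i phi w0).
have av_pos n : posfun (av n).
  split=> [a f h _ _|f _ f0]; last by rewrite mulr_ge0// sumr_ge0.
  by rewrite /av big_split/= -mulr_sumr; ring.
have av1 n : av n (fun=> 1) = 1.
  by rewrite /av sumr_const card_ord mulVf// pnatr_eq0.
have av_bnd f : bnd f -> bnd (av^~ f).
  by move=> [D fD]; exists D => n; have := posfun_norm_le (av_pos n) fD; rewrite av1 mulr1.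
apply: cvg_of_ultra; first exact: (av_bnd _ bnd_continuous).
move=> W UW Woo; change (lim ((av^~ x) @ W) = c).
pose nu h := lim ((av^~ h) @ W).
have pnu : posfun nu by exact: ulim_posfun.
have nu1 : nu (fun=> 1) = 1.
  by apply: ulimP; under eq_fun do rewrite av1; exact: cvg_cst.
have nu_phi h : bnd h -> nu (h \o phi) = nu h.
  move=> /[dup] bh [D hD]; apply: ulim_eq; [|exact: av_bnd|].
    by apply: av_bnd; exists D => t; exact: hD.
  have := @cesaro_shift R (fun i => h (iter i phi w0)) D (fun i => hD _).
  by apply: cvg_trans; exact: (cvg_app _ Woo).
have nu_orbit i : nu (orbit_seq i) = nu x.
  elim: i => [|i IH]; first by congr nu; apply/funext.
  rewrite -IH -[RHS]nu_phi; last by exists C => t; exact: xC.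
  by congr nu; apply/funext => t; rewrite /orbit_seq /= -iterS iterSr.
have nu_block mn : nu (block_mean orbit_seq mn) = nu x.
  rewrite /block_mean (linbZ pnu.1); last first.
    by apply: (@bnd_sum _ _ _ (fun i => orbit_seq (mn.2.+1 + i)%N)) => i; exists C => t; exact: xC.
  rewrite (@linb_sum _ _ _ pnu.1 _ (fun i => orbit_seq (mn.2.+1 + i)%N)); last first.
    by move=> i; exists C => t; exact: xC.
  under eq_bigr do rewrite nu_orbit.
  by rewrite sumr_const card_ord -[nu x *+ _]mulr_natl mulKf// pnatr_eq0.
pose Y : set Omega := [set p w0 | p in EE].
have clY : closed Y.
  apply: compact_closed; first exact: metric_hausdorff.
  apply: (@continuous_compact E Omega (fun p : E => p w0) EE); last exact: compact_env.
  exact/continuous_subspaceT/eval_continuous.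
have nuY f : bnd f -> (forall t, Y t -> f t = 0) -> nu f = 0.
  move=> _ fY; apply: ulimP; rewrite (_ : av^~ f = fun=> 0); first exact: cvg_cst.
  apply/funext => n; rewrite /av big1 ?mulr0// => i _; apply: fY.
  by exists (iter i phi) => //; exact: iter_env.
have [D bD] := bm_bnd.
have Yc t : Y t -> (fun mn => block_mean orbit_seq mn t) @ V --> c.
  by move=> [p Ep <-]; exact: Vc.
rewrite -/(nu x); have [lt|gt|//] := ltgtP (nu x) c; exfalso.
  (* Here the negated block means are used; the levels change sign and trade places, and patterns
     are complemented. *)
  have d0 : 0 < (c - nu x) / 2 by rewrite divr_gt0// subr_gt0.
  have [|||j|al [a [b [ab ind]]]] := @independent_of_limit_lt R Omega cO _ V
    (fun mn t => - block_mean orbit_seq mn t) D (- c) _ Y nu UV _ _ pnu nu1 clY nuY _ d0.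
  - by move=> mn t; apply: cvgN; exact: continuous_block_mean.
  - by move=> mn t; rewrite normrN.
  - by move=> t Yt; apply: cvgN; exact: Yc.
  - rewrite (linbN pnu.1); last by exists D.
    by rewrite nu_block; lra.
  apply: (dep (mn := al) (a := - b) (b := - a)); first by rewrite ltrN2.
  move=> K tau; have [t tP] := ind K (fun k => ~~ tau k); exists t => k kK.
  by have := tP k kK; case: (tau k) => /=; lra.
have d0 : 0 < (nu x - c) / 2 by rewrite divr_gt0// subr_gt0.
have [||j|al [a [b [ab ind]]]] := @independent_of_limit_lt R Omega cO _ V
  (block_mean orbit_seq) D c _ Y nu UV continuous_block_mean _ pnu nu1 clY nuY _ d0.
- by move=> mn t; exact: bD.
- exact: Yc.
- by rewrite nu_block; lra.
exact: (dep (mn := al) ab ind).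
Qed.

End Birkhoff.

(** * Scalars *)

Section Scalars.
Context {R : realType}.
Variable s : scalar_kind.
Local Notation K := (scalar_field R s).
Local Notation mod := (@modulus R s).
Local Notation "r %:K" := (of_real s r) (at level 2, format "r %:K").

Definition scalar_re : K -> R :=
  match s with RealScalars => id | ComplexScalars => @complex.Re R end.
Definition scalar_im : K -> R :=
  match s with RealScalars => fun=> 0 | ComplexScalars => @complex.Im R end.
(** The real case takes the default 0: it only multiplies [scalar_im], which vanishes there. *)
Definition scalar_i : K :=
  match s with RealScalars => 0 | ComplexScalars => 'i%C end.

Lemma scalarE z : z = (scalar_re z)%:K + scalar_i * (scalar_im z)%:K.
Proof.
rewrite /scalar_re /scalar_im /scalar_i; case: s z => z /=; first by rewrite mul0r addr0.
by rewrite [LHS]complexE.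
Qed.

Lemma scalar_re_le z : `|scalar_re z| <= mod z.
Proof.
rewrite /scalar_re; case: s z => //= -[a b] /=.
by rewrite -sqrtr_sqr ler_wsqrtr// lerDl sqr_ge0.
Qed.

Lemma scalar_im_le z : `|scalar_im z| <= mod z.
Proof.
rewrite /scalar_im; case: s z => [z|[a b]] /=; first by rewrite normr0.
by rewrite -sqrtr_sqr ler_wsqrtr// lerDr sqr_ge0.
Qed.

Lemma scalar_reB z z' : scalar_re (z - z') = scalar_re z - scalar_re z'.
Proof. by rewrite /scalar_re; case: s z z' => // -[a b] [c d]. Qed.

Lemma scalar_imB z z' : scalar_im (z - z') = scalar_im z - scalar_im z'.
Proof. by rewrite /scalar_im; case: s z z' => [z z'|[a b] [c d]] //=; rewrite subr0. Qed.

Lemma modulus_of_real (r : R) : mod r%:K = `|r|.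
Proof. by case: s => //=; rewrite expr0n addr0 sqrtr_sqr. Qed.

Lemma of_realD (a b : R) : (a + b)%:K = a%:K + b%:K.
Proof. by case: s => //=; rewrite rmorphD. Qed.

Lemma of_realB (a b : R) : (a - b)%:K = a%:K - b%:K.
Proof. by case: s => //=; rewrite rmorphB. Qed.

Lemma of_realM (a b : R) : (a * b)%:K = a%:K * b%:K.
Proof. by case: s => //=; rewrite rmorphM. Qed.

Lemma of_real0 : (0 : R)%:K = 0.
Proof. by case: s. Qed.

Lemma of_real1 : (1 : R)%:K = 1.
Proof. by case: s. Qed.

Lemma of_real_sum (n : nat) (F : 'I_n -> R) : (\sum_i F i)%:K = \sum_i (F i)%:K.
Proof. exact: (big_morph _ of_realD of_real0). Qed.

Lemma of_real_natV (n : nat) : (n%:R^-1 : R)%:K = n%:R^-1.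
Proof. by case: s => //=; rewrite fmorphV rmorph_nat. Qed.

Lemma modulusN z : mod (- z) = mod z.
Proof. by apply/eqP; rewrite eq_le !modulus_le normrN lexx. Qed.

Lemma modulus_eq0 z : mod z = 0 -> z = 0.
Proof. by move=> z0; apply/eqP; rewrite -normr_eq0 -modulusE z0 of_real0. Qed.

Lemma modulus_sum (n : nat) (F : 'I_n -> K) : mod (\sum_i F i) <= \sum_i mod (F i).
Proof.
elim/big_ind2 : _ => // [|z r z' r' zr zr']; first by rewrite modulus0.
by rewrite (le_trans (modulusD _ _))// lerD.
Qed.

(** The conjugate phase of [z], with value 0 at [z = 0]; it aligns values of a functional before
    they are added. *)
Lemma modulus_phase z : exists2 c, mod c <= 1 & c * z = (mod z)%:K.
Proof.
have [->|z0] := eqVneq z 0.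
  by exists 0; rewrite modulus0 ?ler01// mul0r of_real0.
have mz : mod z != 0 by apply: contra_neq z0 => /modulus_eq0.
exists ((mod z)%:K / z); last by rewrite divfK.
have : mod ((mod z)%:K / z) * mod z = mod z.
  by rewrite -modulusM divfK// modulus_of_real ger0_norm ?modulus_ge0.
by move=> h; rewrite -(ler_pM2r (x := mod z)) ?h ?mul1r// lt0r mz modulus_ge0.
Qed.

Lemma modulus_lt z (e : R) : (mod z < e) = (`|z| < e%:K).
Proof. by rewrite -modulusE; case: s z => z //=; rewrite ltcR. Qed.

Lemma cvg_modulusP (T : Type) (F : set_system T) {FF : Filter F} (u : T -> K) (l : K) :
  u @ F --> l <-> (forall e : R, 0 < e -> \forall t \near F, mod (l - u t) < e).
Proof.
split=> [/cvgrPdist_lt ul e e0|ul].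
  have e0K : 0 < e%:K by case: (s) => //=; rewrite ltcR.
  by apply: filterS (ul _ e0K) => t; rewrite modulus_lt.
apply/cvgrPdist_lt => e e0.
have [r r0 re] : exists2 r : R, 0 < r & e = r%:K.
  clear ul l u; case: s e e0 => [e e0|[a b]] /=; first by exists e.
  by rewrite ltcE/= => /andP[/eqP b0 a0]; exists a => //; rewrite b0.
by rewrite re; apply: filterS (ul _ r0) => t; rewrite modulus_lt.
Qed.

Lemma continuous_of_real : continuous (of_real s : R -> K).
Proof.
move=> r; apply/cvg_modulusP => e e0.
have : \forall t \near r, `|r - t| < e by exact: (nbhsx_ballx r).
by apply: filterS => t; rewrite -of_realB modulus_of_real.
Qed.

Lemma continuous_scalar_re : continuous scalar_re.
Proof.
move=> z; apply/(@cvgrPdist_lt _ _ _ (nbhs z)) => e e0.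
have := iffLR (@cvg_modulusP K (nbhs z) (nbhs_filter z) id z) cvg_id e e0.
by apply: (@filterS _ (nbhs z) (nbhs_filter z)) => t; apply: le_lt_trans; rewrite -scalar_reB scalar_re_le.
Qed.

Lemma continuous_scalar_im : continuous scalar_im.
Proof.
move=> z; apply/(@cvgrPdist_lt _ _ _ (nbhs z)) => e e0.
have := iffLR (@cvg_modulusP K (nbhs z) (nbhs_filter z) id z) cvg_id e e0.
by apply: (@filterS _ (nbhs z) (nbhs_filter z)) => t; apply: le_lt_trans; rewrite -scalar_imB scalar_im_le.
Qed.

Lemma cvg_scalar (T : Type) (F : set_system T) {FF : Filter F} (u : T -> K) (a b : R) :
  (fun t => scalar_re (u t)) @ F --> a -> (fun t => scalar_im (u t)) @ F --> b ->
  u @ F --> a%:K + scalar_i * b%:K.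
Proof.
move=> ua ub; rewrite (_ : u = fun t => (scalar_re (u t))%:K + scalar_i * (scalar_im (u t))%:K).
  apply: cvgD; first exact: (cvg_comp _ _ ua (@continuous_of_real a)).
  by apply: cvgMr; exact: (cvg_comp _ _ ub (@continuous_of_real b)).
by apply/funext => t; exact: scalarE.
Qed.

(** The Cauchy condition uses two index sequences because dominated convergence is available for
    sequences. Completeness is applied to real and imaginary parts. *)
Lemma cvg_scalar_cauchy (u : nat -> K) :
  (forall a b : nat -> nat, (forall k, (k <= a k)%N) -> (forall k, (k <= b k)%N) ->
     (fun k => mod (u (a k) - u (b k))) @ \oo --> (0 : R)) ->
  exists l : K, u @ \oo --> l.
Proof.
move=> H.
have cau (e : R) : 0 < e -> exists N, forall i j, (N <= i)%N -> (N <= j)%N ->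
    mod (u i - u j) < e.
  move=> e0; apply: contrapT => /forallNP no.
  have pick N : exists ij : nat * nat, [/\ (N <= ij.1)%N, (N <= ij.2)%N &
      e <= mod (u ij.1 - u ij.2)].
    apply: contrapT => /forallNP no'; apply: (no N) => i j Ni Nj.
    by rewrite ltNge; apply/negP => h; apply: (no' (i, j)).
  have [ij ijP] := choice pick.
  have /cvgrPdist_lt/(_ _ e0) := H (fun k => (ij k).1) (fun k => (ij k).2)
    (fun k => let: And3 h _ _ := ijP k in h) (fun k => let: And3 _ h _ := ijP k in h).
  move=> /filter_ex[k]; rewrite sub0r normrN ger0_norm ?modulus_ge0//.
  by have [_ _ h] := ijP k; rewrite ltNge h.
have cvgR (f : K -> R) : (forall z z', `|f z - f z'| <= mod (z - z')) ->
    exists a : R, (fun k => f (u k)) @ \oo --> a.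
  move=> fle; suff cf : cvgn (fun k => f (u k)) by exists (limn (fun k => f (u k))).
  apply/cauchy_cvgP/cauchy_ballP => e e0.
  have [N NP] := cau e e0.
  exists ([set f (u k) | k in [set k | (N <= k)%N]], [set f (u k) | k in [set k | (N <= k)%N]]).
    by split; exists N => // k /= Nk; exists k.
  by move=> [_ _] [[i /= Ni <-] [j /= Nj <-]] /=; rewrite /ball/= (le_lt_trans (fle _ _))// NP.
have [|a ua] := cvgR scalar_re; first by move=> z z'; rewrite -scalar_reB scalar_re_le.
have [|b ub] := cvgR scalar_im; first by move=> z z'; rewrite -scalar_imB scalar_im_le.
by exists (a%:K + scalar_i * b%:K); exact: cvg_scalar.
Qed.

End Scalars.

(** * Bounded pointwise convergence *)

Section Luxemburg.
Context {R : realType} {X : topologicalType}.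
Hypothesis cX : compact [set: X].

(** If the decreasing closed sets [e <= m n] were all nonempty, compactness would give a common
    point, against pointwise convergence. *)
Lemma dini (m : nat -> X -> R) : (forall n, continuous (m n)) ->
  (forall n t, m n.+1 t <= m n t) ->
  (forall t (e : R), 0 < e -> exists n, m n t < e) ->
  forall e : R, 0 < e -> exists n, forall t, m n t < e.
Proof.
move=> cm dm m0 e e0; apply: contrapT => /forallNP no.
have mono t i j : (i <= j)%N -> m j t <= m i t.
  by move=> /subnKC <-; elim: (j - i)%N => [|d IH]; rewrite ?addn0// addnS (le_trans (dm _ _)).
pose A n := [set t | e <= m n t].
pose F := [set S : set X | exists n, A n `<=` S].
have PF : ProperFilter F.
  apply: Build_ProperFilter_ex.
    move=> S [n AS]; have /existsNP[t /negP] := no n.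
    by rewrite -leNgt => h; exists t; exact: AS.
  split.
  - by exists 0%N.
  - move=> S S' [n AS] [n' AS']; exists (maxn n n') => t At; split.
      by apply: AS; rewrite /A/= (le_trans At)// mono// leq_maxl.
    by apply: AS'; rewrite /A/= (le_trans At)// mono// leq_maxr.
  - by move=> S S' SS' [n AS]; exists n; exact: subset_trans SS'.
have [t [_ clt]] := cX PF filterT.
have [n mn] := m0 t e e0.
have Ant : A n t.
  have clA : closed (A n) by apply: (@closed_comp _ _ (m n) [set v | e <= v]) => // u _; exact: cm.
  by apply: clA => B tB; apply: clt => //; exists n.
by move: Ant; rewrite /A/= leNgt mn.
Qed.

Definition cts_ge0 (h : X -> R) := continuous h /\ forall t, 0 <= h t.

Variables (v : (X -> R) -> R) (D : R) (h : nat -> X -> R) (C : R).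
Hypothesis v_le : forall f g, cts_ge0 f -> cts_ge0 g -> (forall t, f t <= g t) -> v f <= v g.
Hypothesis v_add : forall f g, cts_ge0 f -> cts_ge0 g -> v (fun t => f t + g t) = v f + v g.
Hypothesis v_bnd : forall f c, cts_ge0 f -> 0 <= c -> (forall t, f t <= c) ->
  0 <= v f <= D * c.
Hypothesis C0 : 0 <= C.
Hypothesis h0 : forall n, cts_ge0 (h n).
Hypothesis hC : forall n t, h n t <= C.
Hypothesis h_cvg : forall t, (h^~ t) @ \oo --> 0.

(** Generated inductively, so that closure under maxima is a constructor and bounds follow by
    induction. *)
Inductive tail_max (n : nat) : (X -> R) -> Prop :=
| tail_max1 k : (n <= k)%N -> tail_max n (h k)
| tail_maxU f g : tail_max n f -> tail_max n g -> tail_max n (fun t => Num.max (f t) (g t)).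

Let cts_max f g : cts_ge0 f -> cts_ge0 g -> cts_ge0 (fun t => Num.max (f t) (g t)).
Proof.
move=> [cf f0] [cg g0]; split; last by move=> t; rewrite le_max f0.
by move=> t; apply: continuous_max; [exact: cf|exact: cg].
Qed.

Let cts_min f g : cts_ge0 f -> cts_ge0 g -> cts_ge0 (fun t => Num.min (f t) (g t)).
Proof.
move=> [cf f0] [cg g0]; split; last by move=> t; rewrite le_min f0 g0.
by move=> t; apply: continuous_min; [exact: cf|exact: cg].
Qed.

Let tail_max_ge0 n f : tail_max n f -> cts_ge0 f.
Proof. by elim=> // {}f g _ ? _ ?; exact: cts_max. Qed.

Let tail_max_le n f c t : tail_max n f -> (forall k, (n <= k)%N -> h k t <= c) -> f t <= c.
Proof. by elim=> [k nk H|{}f g _ IH1 _ IH2 H]; [exact: H|rewrite ge_max IH1// IH2]. Qed.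

Let tail_max_sub n m f : (n <= m)%N -> tail_max m f -> tail_max n f.
Proof.
move=> nm; elim=> [k mk|{}f g _ ? _ ?]; last exact: tail_maxU.
by apply: tail_max1; exact: leq_trans nm mk.
Qed.

Let v_mod f g : cts_ge0 f -> cts_ge0 g ->
  v (fun t => Num.min (f t) (g t)) + v (fun t => Num.max (f t) (g t)) = v f + v g.
Proof.
move=> f0 g0; rewrite -!v_add//; [|exact: cts_min|exact: cts_max].
by congr v; apply/funext => t; exact: addr_min_max.
Qed.

(* Luxemburg's proof of Arzela's theorem: near-maximizers [g n] of [v] among the
   finite maxima of tails have almost maximal minima [m n], by modularity of
   [v], and [m n] tends to 0 uniformly by Dini's theorem. *)
Lemma luxemburg : (fun n => v (h n)) @ \oo --> 0.
Proof.
pose L n := sup [set v f | f in tail_max n].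
have supL n : has_sup [set v f | f in tail_max n].
  split; first by exists (v (h n)), (h n) => //; exact: tail_max1.
  exists (D * C) => _ [f fn <-].
  by have /andP[] := v_bnd (tail_max_ge0 fn) C0 (fun t => tail_max_le (t := t) fn (fun k _ => hC k t)).
have L_ub n f : tail_max n f -> v f <= L n.
  by move=> fn; apply: ub_le_sup; [case: (supL n)|exists f].
apply/cvgrPdist_lt => e e0.
(* The losses up to rank [n] add up to [e / 2 - ep n]. *)
pose ep n := e / 2 / 2 ^+ n.+1.
have ep0 n : 0 < ep n by rewrite !divr_gt0// exprn_gt0.
have epS n : ep n.+1 = ep n / 2 by rewrite /ep [in LHS]exprS invfM; ring.
have gP n : exists g, tail_max n g /\ L n - ep n < v g.
  by have [_ [g gn <-] Lg] := sup_adherent (ep0 n) (supL n); exists g.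
have [g gP'] := choice gP.
have gn n := (gP' n).1; have gL n := (gP' n).2.
pose m := fix m n : X -> R := if n is n'.+1 then fun t => Num.min (m n' t) (g n'.+1 t) else g 0%N.
have m0 n : cts_ge0 (m n).
  elim: n => [|n IH] /=; first exact: tail_max_ge0 (gn 0%N).
  exact: cts_min IH (tail_max_ge0 (gn _)).
have mg n t : m n t <= g n t by case: n => //= n; rewrite ge_min lexx orbT.
(* By modularity the value of the new minimum is [v (m n) + v (g n.+1)] minus that of a maximum,
   which lies below a tail maximum from rank [n] and so costs at most [L n]. *)
have mL n : L n - (e / 2 - ep n) <= v (m n).
  elim: n => [|n IH].
    by have := gL 0%N; rewrite /= /ep expr1; lra.
  have := v_mod (m0 n) (tail_max_ge0 (gn n.+1)).
  have : v (fun t => Num.max (m n t) (g n.+1 t)) <= L n.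
    apply: le_trans (L_ub n _ (tail_maxU (gn n) (tail_max_sub (leqnSn n) (gn n.+1)))).
    apply: v_le; [exact: cts_max (m0 n) (tail_max_ge0 (gn _))| |].
      exact: cts_max (tail_max_ge0 (gn _)) (tail_max_ge0 (gn _)).
    by move=> t; rewrite ge_max !le_max mg lexx orbT.
  by have := gL n.+1; have := epS n; rewrite /=; lra.
pose D' := `|D| + 1.
have D'0 : 0 < D' by rewrite ltr_wpDl.
have e20 : 0 < e / 2 / D' by rewrite !divr_gt0.
have [||t d d0|N mN] := @dini m _ _ _ _ e20.
- by move=> n; exact: (m0 n).1.
- by move=> n t; rewrite /= ge_min lexx.
- have d20 : 0 < d / 2 by rewrite divr_gt0.
  have /cvgrPdist_lt/(_ _ d20)[n _ nP] := @h_cvg t.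
  exists n; apply: (@le_lt_trans _ _ (d / 2)); last by rewrite gtr_pMr// invf_lt1// ltr1n.
  rewrite (le_trans (mg _ _))//; apply: (tail_max_le (gn n)) => k nk.
  have := nP k nk; rewrite sub0r normrN => /ltW; apply: le_trans; exact: ler_norm.
have /andP[_ vmN] := v_bnd (m0 N) (ltW e20) (fun t => ltW (mN t)).
have vmN' : v (m N) <= e / 2.
  apply: (le_trans vmN); rewrite mulrCA ger_pMr ?divr_gt0//.
  by rewrite ler_pdivrMr// mul1r /D' (le_trans (ler_norm D))// lerDl.
exists N => // n /= Nn; rewrite sub0r normrN.
have /andP[vn0 _] := v_bnd (h0 n) C0 (hC n).
rewrite ger0_norm//.
have := L_ub N _ (tail_max1 Nn); have := mL N; have := ep0 N; lra.
Qed.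

End Luxemburg.

(** * Total variation of a functional and dominated convergence *)

Section DominatedConvergence.
Context {R : realType} {Omega : metricType R} {s : scalar_kind}.
Hypothesis cO : compact [set: Omega].
Local Notation K := (scalar_field R s).
Local Notation X := (continuousType Omega K).
Local Notation mod := (@modulus R s).

Section Variation.
Variable y : dual Omega s.

Lemma dual_linear a (f g : X) : y (a *: f + g) = a * y f + y g.
Proof.
have /set_mem[yl _] : (y : X -> K) \in dual_pred (s := s) by exact: valP.
exact: yl.
Qed.

Lemma dualD (f g : X) : y (f + g) = y f + y g.
Proof. by rewrite -[f]scale1r dual_linear mul1r scale1r. Qed.

Lemma dual0 : y 0 = 0.
Proof.
by have := dual_linear (-1) 0 0; rewrite scaler0 addr0 mulN1r addNr.
Qed.

Lemma dualZ a (f : X) : y (a *: f) = a * y f.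
Proof. by rewrite -[a *: f]addr0 dual_linear dual0 addr0. Qed.

Lemma dualB (f g : X) : y (f - g) = y f - y g.
Proof. by rewrite dualD -scaleN1r dualZ mulN1r. Qed.

Lemma dual_bounded : exists2 M : R, 0 <= M & forall f : X, mod (y f) <= M * sup_norm f.
Proof.
have /set_mem[_ [M yM]] : (y : X -> K) \in dual_pred (s := s) by exact: valP.
exists `|M| => // f; rewrite (le_trans (yM f))// ler_wpM2r ?sup_norm_ge0//.
exact: ler_norm.
Qed.

(** For continuous nonnegative [h], this is the integral of [h] against the total variation of [y],
    expressed without measures. *)
Definition variation (h : Omega -> R) : R :=
  sup [set mod (y g) | g in [set g : X | forall w, mod (g w) <= h w]].

Lemma variation_bnd : exists2 M : R, 0 <= M & forall h c, cts_ge0 h -> 0 <= c ->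
  (forall w, h w <= c) ->
  (forall g : X, (forall w, mod (g w) <= h w) -> mod (y g) <= M * c) /\
  0 <= variation h <= M * c.
Proof.
have [M M0 yM] := dual_bounded; exists M => // h c [_ h0] c0 hc.
have key (g : X) : (forall w, mod (g w) <= h w) -> mod (y g) <= M * c.
  move=> gh; rewrite (le_trans (yM g))// ler_wpM2l// sup_norm_le// => w.
  exact: le_trans (gh w) (hc w).
have z0 w : mod ((0 : X) w) <= h w by have -> : (0 : X) w = 0 by []; rewrite modulus0.
split=> //; apply/andP; split.
  rewrite -(modulus0 R s) -dual0; apply: ub_le_sup; last by exists 0.
  by exists (M * c) => _ [g gh <-]; exact: key.
by apply: ge_sup => [|_ [g gh <-]]; [exists (mod (y 0)), 0|exact: key].
Qed.

Lemma cts_ge0_bounded h : cts_ge0 h -> exists2 c : R, 0 <= c & forall w : Omega, h w <= c.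
Proof.
move=> [ch h0]; have [C hC] := bnd_continuous cO ch.
by exists `|C| => // w; rewrite (le_trans (ler_norm _))// (le_trans (hC w))// ler_norm.
Qed.

Lemma variation_ub (h : Omega -> R) (g : X) : cts_ge0 h ->
  (forall w, mod (g w) <= h w) -> mod (y g) <= variation h.
Proof.
move=> ch gh; have [c c0 hc] := cts_ge0_bounded ch.
have [M _ /(_ h c ch c0 hc)[key _]] := variation_bnd.
by apply: ub_le_sup; [exists (M * c) => _ [f fh <-]; exact: key|exists g].
Qed.

Lemma variation_lub (h : Omega -> R) (c : R) : cts_ge0 h ->
  (forall g : X, (forall w, mod (g w) <= h w) -> mod (y g) <= c) -> variation h <= c.
Proof.
move=> [_ h0] H; apply: ge_sup => [|_ [g gh <-]]; last exact: H.
by exists (mod (y 0)), 0 => // w; have -> : (0 : X) w = 0 by []; rewrite modulus0.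
Qed.

Lemma variation_approx (h : Omega -> R) (e : R) : cts_ge0 h -> 0 < e ->
  exists2 g : X, (forall w, mod (g w) <= h w) & variation h - e < mod (y g).
Proof.
move=> ch e0; apply: contrapT => no.
have : variation h <= variation h - e.
  apply: variation_lub => // g gh; rewrite leNgt; apply/negP => lt.
  by apply: no; exists g.
by lra.
Qed.

Lemma variation_le f g : cts_ge0 f -> cts_ge0 g -> (forall w, f w <= g w) ->
  variation f <= variation g.
Proof.
move=> cf cg fg; apply: variation_lub => // u uf; apply: variation_ub => // w.
exact: le_trans (uf w) (fg w).
Qed.

(** Superadditivity: near-maximizers for [f] and [g] are rotated to align the phases. Subadditivity:
    a function dominated by [f + g] is split in proportion to [f] and [g]. *)
Lemma variation_add f g : cts_ge0 f -> cts_ge0 g ->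
  variation (fun w => f w + g w) = variation f + variation g.
Proof.
move=> cf cg.
have cfg : cts_ge0 (fun w => f w + g w).
  split=> [w|w]; first by apply: cvgD; [exact: cf.1|exact: cg.1].
  by rewrite addr_ge0 ?cf.2 ?cg.2.
have f0 := cf.2; have g0 := cg.2.
apply/eqP; rewrite eq_le; apply/andP; split; last first.
  apply/ler_addgt0Pl => e e0; have e20 : 0 < e / 2 by rewrite divr_gt0.
  have [u uf yu] := variation_approx cf e20.
  have [u' u'g yu'] := variation_approx cg e20.
  have [c c1 cu] := modulus_phase (y u).
  have [c' c'1 cu'] := modulus_phase (y u').
  have : mod (y (c *: u + c' *: u')) <= variation (fun w => f w + g w).
    apply: variation_ub => // w.
    have -> : (c *: u + c' *: u') w = c * u w + c' * u' w by [].
    rewrite (le_trans (modulusD _ _))// !modulusM lerD//.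
      by rewrite -[leRHS]mul1r ler_pM ?modulus_ge0.
    by rewrite -[leRHS]mul1r ler_pM ?modulus_ge0.
  rewrite dual_linear dualZ cu cu' -of_realD modulus_of_real ger0_norm; last first.
    by rewrite addr_ge0 ?modulus_ge0.
  lra.
apply: variation_lub => // u ufg.
have [M M0 yM] := dual_bounded.
apply/ler_addgt0Pl => e e0.
(* Adding [d] keeps the denominators positive; the third part of [u] has norm at most [d] and costs
   at most [M * d <= e]. *)
pose d := e / (M + 1).
have M1 : 0 < M + 1 by rewrite ltr_wpDl.
have d0 : 0 < d by rewrite divr_gt0.
have den w : 0 < f w + g w + d by rewrite ltr_wpDl// addr_ge0.
pose part (h : Omega -> R) w : K := u w * of_real s (h w / (f w + g w + d)).
have part_cts h : continuous h -> continuous (part h).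
  move=> ch w; apply: cvgM; first exact: (@cts_fun _ _ u w).
  apply: (@continuous_comp _ _ _ (fun w => h w / (f w + g w + d)) (of_real s)); last first.
    exact: continuous_of_real.
  apply: cvgM; first exact: ch.
  apply: cvgV; first by rewrite gt_eqF.
  by apply: cvgD; [exact: cfg.1|exact: cvg_cst].
have part_le h w : 0 <= h w -> mod (part h w) <= h w.
  move=> hw; rewrite /part modulusM modulus_of_real.
  have q0 : 0 <= h w / (f w + g w + d) by rewrite divr_ge0// ltW.
  rewrite (ger0_norm q0) mulrCA ler_piMr// ler_pdivrMr// mul1r.
  by rewrite (le_trans (ufg w))// lerDl ltW.
pose uf : X := mkcts (part_cts f cf.1).
pose ug : X := mkcts (part_cts g cg.1).
have cd : continuous (fun _ : Omega => d) by move=> w; exact: cvg_cst.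
pose ud : X := mkcts (part_cts (fun=> d) cd).
have uE : u = uf + ug + ud.
  apply/continuousEP => w.
  have -> : (uf + ug + ud) w = part f w + part g w + part (fun=> d) w by [].
  by rewrite /part -!mulrDr -!of_realD -!mulrDl divff ?gt_eqF// of_real1 mulr1.
rewrite uE !dualD (le_trans (modulusD _ _))// addrC lerD//.
  rewrite (le_trans (yM _))//.
  have : sup_norm ud <= d.
    by apply: sup_norm_le => [|w]; [exact: ltW|apply: part_le; exact: ltW].
  move=> /(ler_wpM2l M0) h; apply: (le_trans h).
  by rewrite /d mulrCA ger_pMr// ler_pdivrMr// mul1r lerDl.
rewrite (le_trans (modulusD _ _))// lerD//; apply: variation_ub => // w; exact: part_le.
Qed.

End Variation.

(** [mod (y (f n))] is at most the variation at [mod (f n)], a monotone additive functional covered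
    by [luxemburg]. *)
Lemma dual_dominated_cvg (y : dual Omega s) (f : nat -> X) (C : R) :
  (forall n w, mod (f n w) <= C) ->
  (forall w, (fun n => mod (f n w)) @ \oo --> (0 : R)) ->
  (fun n => mod (y (f n))) @ \oo --> (0 : R).
Proof.
move=> fC f0.
have [M M0 vM] := variation_bnd y.
have ch n : cts_ge0 (fun w => mod (f n w)).
  split=> [w|w]; last exact: modulus_ge0.
  exact: (continuous_comp (cts_fun w) (@continuous_modulus R s _)).
have fC' n w : mod (f n w) <= `|C| by rewrite (le_trans (fC n w))// ler_norm.
have := @luxemburg R Omega cO (variation y) M (fun n w => mod (f n w)) `|C|
  (@variation_le y) (@variation_add y)
  (fun h c ch c0 hc => (vM h c ch c0 hc).2) (normr_ge0 C) ch fC' f0.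
apply: squeeze_cvgr; last exact: cvg_cst.
by near=> n; rewrite modulus_ge0/= variation_ub.
Unshelve. all: end_near. Qed.

End DominatedConvergence.

(** * Pointwise criterion *)

Section PointwiseCriterion.
Context {R : realType} {Omega : metricType R} {s : scalar_kind}.
Hypothesis cO : compact [set: Omega].
Variable phi : continuousType Omega Omega.
Local Notation K := (scalar_field R s).
Local Notation X := (continuousType Omega K).
Local Notation mod := (@modulus R s).

Definition koopman_mean (n : nat) (x : X) : X :=
  n%:R^-1 *: \sum_(i < n) iter i (koopman phi) x.

Lemma cts_sumE (n : nat) (F : 'I_n -> X) w : (\sum_i F i) w = \sum_i F i w.
Proof. exact: (big_morph (fun g : X => g w)). Qed.

Lemma koopman_meanE n (x : X) w :
  koopman_mean n x w = n%:R^-1 * \sum_(i < n) x (iter i phi w).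
Proof.
have -> : koopman_mean n x w = n%:R^-1 * (\sum_(i < n) iter i (koopman phi) x) w by [].
by rewrite cts_sumE; congr (_ * _); apply: eq_bigr => i _; exact: iter_koopmanE.
Qed.

Lemma koopman_mean_linear n : linear (koopman_mean n).
Proof.
move=> a x y; apply/continuousEP => w.
have -> : (a *: koopman_mean n x + koopman_mean n y) w =
  a * koopman_mean n x w + koopman_mean n y w by [].
rewrite !koopman_meanE mulrCA -mulrDr; congr (_ * _).
rewrite mulr_sumr -big_split /=; exact: eq_bigr.
Qed.

Lemma modulus_koopman_mean n x w : mod (koopman_mean n x w) <= sup_norm x.
Proof.
rewrite koopman_meanE modulusM -of_real_natV modulus_of_real ger0_norm ?invr_ge0//.
case: n => [|n]; first by rewrite invr0 mul0r sup_norm_ge0.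
rewrite ler_pdivrMl ?ltr0Sn// (le_trans (modulus_sum _))//.
apply: (@le_trans _ _ (\sum_(i < n.+1) sup_norm x)).
  by apply: ler_sum => i _; exact: sup_norm_ub.
by rewrite sumr_const card_ord mulr_natl.
Qed.

Lemma pairing_cesaro_mean n (x : X) (y : dual Omega s) :
  pairing x (cesaro_mean cO phi n y) = y (koopman_mean n x).
Proof.
have adjE i (z : X) : (iter i (koopman_adj cO phi) y : dual Omega s) z =
    y (iter i (koopman phi) z).
  by elim: i z => // i IH z; rewrite iterS iterSr -IH.
have -> : pairing x (cesaro_mean cO phi n y) = n%:R^-1 *
    (\sum_(i < n) iter i (koopman_adj cO phi) y : dual Omega s) x by [].
rewrite (big_morph (fun z : dual Omega s => z x) (id1 := 0) (op1 := +%R))//.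
rewrite dualZ; congr (_ * _).
rewrite (big_morph (y : X -> K) (id1 := 0) (op1 := +%R)); [|exact: dualD|exact: dual0].
by apply: eq_bigr => i _; exact: adjE.
Qed.

Lemma dual_norm_ub (y : dual Omega s) (x : X) : sup_norm x <= 1 ->
  mod (y x) <= dual_norm y.
Proof.
move=> x1; have [M M0 yM] := dual_bounded y.
apply: ub_le_sup; last by exists x.
exists M => _ [z /= z1 <-]; rewrite (le_trans (yM z))//.
by rewrite -[leRHS]mulr1 ler_wpM2l.
Qed.

(** By duality the means of [V] acting on [y] are [y] applied to the means of [U]; the limits of
    these numbers define the operator. *)
Lemma WstarO_convergent_of_pointwise (n : nat -> nat) :
  (forall (x : X) w, exists l : K, (fun k => koopman_mean (n k) x w) @ \oo --> l) ->
  WstarO_convergent (fun k => cesaro_mean (s := s) cO phi (n k)).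
Proof.
move=> ptw.
have cvgy (y : dual Omega s) (x : X) :
    exists l : K, (fun k => y (koopman_mean (n k) x)) @ \oo --> l.
  (* The pointwise limit of the means may be discontinuous, outside the domain of [y]; differences
     of means are continuous and tend pointwise to 0. *)
  apply: cvg_scalar_cauchy => a b ak bk.
  under eq_fun do rewrite -dualB.
  apply: (@dual_dominated_cvg R Omega s cO y
    (fun k => koopman_mean (n (a k)) x - koopman_mean (n (b k)) x) (2 * sup_norm x)).
    move=> k w.
    have -> : (koopman_mean (n (a k)) x - koopman_mean (n (b k)) x) w =
      koopman_mean (n (a k)) x w - koopman_mean (n (b k)) x w by [].
    rewrite (le_trans (modulusD _ _))// modulusN mulrDl mul1r.
    by rewrite lerD ?modulus_koopman_mean.
  move=> w; have [l xl] := ptw x w.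
  have sub (c : nat -> nat) : (forall k, (k <= c k)%N) ->
      (fun k => koopman_mean (n (c k)) x w) @ \oo --> l.
    move=> ck; apply: (cvg_comp c _ _ xl) => A [N _ NA].
    by exists N => // k /= Nk; apply: NA => /=; exact: leq_trans Nk (ck k).
  have : (fun k => koopman_mean (n (a k)) x w - koopman_mean (n (b k)) x w) @ \oo --> l - l.
    by apply: cvgB; exact: sub.
  rewrite subrr => /cvg_modulusP h0.
  apply/cvgrPdist_lt => e e0; apply: filterS (h0 e e0) => k.
  by rewrite sub0r modulusN sub0r normrN ger0_norm ?modulus_ge0.
pose T0 (y : dual Omega s) (x : X) : K := lim ((fun k => y (koopman_mean (n k) x)) @ \oo).
have T0cvg (y : dual Omega s) (x : X) : (fun k => y (koopman_mean (n k) x)) @ \oo --> T0 y x.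
  by have [l yl] := cvgy y x; rewrite /T0 (cvg_lim _ yl).
have T0uniq (y : dual Omega s) (x : X) (l : K) : (fun k => y (koopman_mean (n k) x)) @ \oo --> l -> T0 y x = l.
  by move=> yl; apply: (cvg_lim _ yl).
have T0le (y : dual Omega s) (x : X) (c : R) : (forall k, mod (y (koopman_mean (n k) x)) <= c) -> mod (T0 y x) <= c.
  move=> H; apply/ler_addgt0Pl => e e0.
  have /cvg_modulusP/(_ e e0) := T0cvg y x.
  move=> /filter_ex[k /ltW h].
  by rewrite -[T0 y x](subrK (y (koopman_mean (n k) x))) (le_trans (modulusD _ _))// lerD.
have T0dual (y : dual Omega s) : T0 y \in dual_pred (s := s).
  apply/mem_set; split.
    move=> a u w; apply: T0uniq.
    have : (fun k => a * y (koopman_mean (n k) u) + y (koopman_mean (n k) w)) @ \oo -->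
      a * T0 y u + T0 y w.
      by apply: cvgD; [apply: cvgMr; exact: T0cvg|exact: T0cvg].
    by under [X in X @ _ --> _ -> _]eq_fun do rewrite -dual_linear -koopman_mean_linear.
  have [M M0 yM] := dual_bounded y; exists M => x.
  apply: T0le => k; rewrite (le_trans (yM _))// ler_wpM2l// sup_norm_le ?sup_norm_ge0// => w.
  exact: modulus_koopman_mean.
pose T (y : dual Omega s) : dual Omega s := Dual (T0dual y).
have Tlin : linear T.
  move=> a y z; apply/val_inj/funext => x /=; apply: T0uniq.
  have : (fun k => a * y (koopman_mean (n k) x) + z (koopman_mean (n k) x)) @ \oo -->
      a * T0 y x + T0 z x.
    by apply: cvgD; [apply: cvgMr; exact: T0cvg|exact: T0cvg].
  exact.
pose TL := HB.pack_for {linear dual Omega s -> dual Omega s} T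
  (GRing.isLinear.Build K (dual Omega s) (dual Omega s) *:%R T Tlin).
exists TL.
  (* The means of [U] do not increase the sup norm, so the limit has norm at most 1. *)
  exists 1 => y; rewrite mul1r; apply: ge_sup.
    exists (mod (T y 0)), 0 => //=; rewrite sup_norm_le// => w.
    by have -> : (0 : X) w = 0 by []; rewrite modulus0.
  move=> _ [x /= x1 <-]; apply: T0le => k; apply: dual_norm_ub.
  rewrite sup_norm_le// => w; exact: le_trans (modulus_koopman_mean _ _ _) x1.
move=> x y.
rewrite (_ : (fun k => _) = (fun k => y (koopman_mean (n k) x))).
  exact: (T0cvg y x).
by apply/funext => k; exact: pairing_cesaro_mean.
Qed.

Lemma WstarO_convergent_of_real (n : nat -> nat) :
  (forall (x : Omega -> R) w, continuous x -> exists c : R,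
     (fun k => (n k)%:R^-1 * \sum_(i < n k) x (iter i phi w)) @ \oo --> c) ->
  WstarO_convergent (fun k => cesaro_mean (s := s) cO phi (n k)).
Proof.
move=> H; apply: WstarO_convergent_of_pointwise => x w.
have cre : continuous (@scalar_re R s \o x).
  by move=> t; apply: continuous_comp; [exact: cts_fun|exact: continuous_scalar_re].
have cim : continuous (@scalar_im R s \o x).
  by move=> t; apply: continuous_comp; [exact: cts_fun|exact: continuous_scalar_im].
have [a xa] := H _ w cre; have [b xb] := H _ w cim.
exists (of_real s a + scalar_i s * of_real s b).
have -> : (fun k => koopman_mean (n k) x w) = (fun k =>
    of_real s ((n k)%:R^-1 * \sum_(i < n k) (@scalar_re R s \o x) (iter i phi w)) +
    scalar_i s * of_real s ((n k)%:R^-1 * \sum_(i < n k) (@scalar_im R s \o x) (iter i phi w))).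
  apply/funext => k; rewrite koopman_meanE !of_realM !of_real_sum of_real_natV.
  rewrite mulrCA -mulrDr; congr (_ * _).
  rewrite mulr_sumr -big_split /=; apply: eq_bigr => i _; exact: scalarE.
apply: cvgD; first exact: (cvg_comp _ _ xa (@continuous_of_real R s a)).
by apply: cvgMr; exact: (cvg_comp _ _ xb (@continuous_of_real R s b)).
Qed.

End PointwiseCriterion.

(** * Ordinary semicascades *)

Section Ordinary.
Context {R : realType} {Omega : metricType R}.
Hypothesis cO : compact [set: Omega].
Variable phi : continuousType Omega Omega.
Local Notation E := {ptws Omega -> Omega}.
Local Notation EE := (enveloping_semigroup phi : set E).
Local Notation E' := (set_type EE).

Lemma nbhs_env (p : E') (A : set E') : nbhs p A ->
  exists2 W : set E, nbhs (set_val p) W & forall q : E', W (set_val q) -> A q.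
Proof.
rewrite nbhsE => -[B [[W oW WB] Bp] BA].
exists W; first by apply: open_nbhs_nbhs; split => //; move: Bp; rewrite -WB.
by move=> q Wq; apply: BA; rewrite -WB.
Qed.

Variable d : E' -> E' -> R.
Hypothesis d_tri : forall p q r, d p r <= d p q + d q r.
Hypothesis d_nbhs : forall (p : E') (A : set E'), nbhs p A <->
  exists2 e : R, 0 < e & [set q | d p q < e] `<=` A.

Lemma d_ball (p : E') (e : R) : 0 < e ->
  exists2 W : set E, nbhs (set_val p) W & forall q : E', W (set_val q) -> d p q < e.
Proof.
move=> e0; have [W pW WA] := @nbhs_env p [set q | d p q < e] (iffRL (d_nbhs _ _) (ex_intro2 _ _ e e0 (fun _ h => h))).
by exists W.
Qed.

(** Otherwise the sets containing all points far from some finite list form a proper filter; a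
    cluster point, added to the list, contradicts itself. Net points are given by index, to serve as
    class labels. *)
Lemma finite_net (e : R) : 0 < e ->
  exists ps : seq E', forall q, exists2 i, (i < size ps)%N & forall p0, d (nth p0 ps i) q < e.
Proof.
move=> e0; apply: contrapT => /forallNP no.
pose F := [set S : set E | exists ps : seq E', forall q : E',
  (forall p, p \in ps -> e <= d p q) -> S (set_val q)].
have PF : ProperFilter F.
  apply: Build_ProperFilter_ex.
    move=> S [ps pS]; have /existsNP[q qP] := no ps.
    exists (set_val q); apply: pS => p pps; rewrite leNgt; apply/negP => pq.
    apply: qP; exists (index p ps); first by rewrite index_mem.
    by move=> p0; rewrite nth_index.
  split.
  - by exists [::].
  - move=> S S' [ps pS] [ps' pS']; exists (ps ++ ps') => q H; split.
      by apply: pS => p pps; apply: H; rewrite mem_cat pps.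
    by apply: pS' => p pps; apply: H; rewrite mem_cat pps orbT.
  - by move=> S S' SS' [ps pS]; exists ps => q /pS/SS'.
have FE : F EE by exists [::] => q _; exact: set_valP.
have [p [Ep clp]] := compact_env cO PF FE.
pose p' : E' := SigSub (mem_set Ep).
have [W pW WA] := d_ball p' e0.
have Fp : F [set set_val q | q in [set q | e <= d p' q]].
  by exists [:: p'] => q H; exists q => //=; apply: H; rewrite mem_head.
have [r [[q /= eq <-] Wq]] := clp _ W Fp pW.
by have := WA q Wq; rewrite ltNge eq.
Qed.

Lemma eval_unif_continuous (f : Omega -> R) (w : Omega) (e : R) : continuous f -> 0 < e ->
  exists2 delta : R, 0 < delta & forall p q : E', d p q < delta ->
    `|f (set_val p w) - f (set_val q w)| < e.
Proof.
move=> cf e0; apply: contrapT => no.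
(* Members of [G] contain the first point of every close pair violating [e]. Near a cluster point
   the second point is close too, against continuity there. *)
pose G := [set S : set E | exists2 dl : R, 0 < dl & forall p q : E', d p q < dl ->
  e <= `|f (set_val p w) - f (set_val q w)| -> S (set_val p)].
have PG : ProperFilter G.
  apply: Build_ProperFilter_ex.
    move=> S [dl dl0 H]; apply: contrapT => nS; apply: no; exists dl => // p q pq.
    by rewrite ltNge; apply/negP => h; apply: nS; exists (set_val p); exact: H h.
  split.
  - by exists 1.
  - move=> S S' [dl dl0 H] [dl' dl'0 H']; exists (Num.min dl dl'); first by rewrite lt_min dl0.
    by move=> p q; rewrite lt_min => /andP[h h'] ?; split; [exact: (H _ q)|exact: (H' _ q)].
  - by move=> S S' SS' [dl dl0 H]; exists dl => // p q pq h; apply: SS'; exact: H h.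
have GE : G EE by exists 1 => // p q _ _; exact: set_valP.
have [p [Ep clp]] := compact_env cO PG GE.
pose p' : E' := SigSub (mem_set Ep).
have e20 : 0 < e / 2 by rewrite divr_gt0.
have [eta eta0 etaP] : exists2 eta : R, 0 < eta &
    forall q : E', d p' q < eta -> `|f (p w) - f (set_val q w)| < e / 2.
  have cfw : continuous (fun q : E => f (q w)).
    by move=> q; apply: (@continuous_comp _ _ _ (fun q : E => q w)); [exact: eval_continuous|exact: cf].
  have cfw' : continuous (fun q : E' => f (set_val q w)).
    have cval : continuous (set_val : E' -> E) by exact: initial_continuous.
    by move=> q; exact: (continuous_comp (cval q) (cfw _)).
  have /cvgrPdist_lt/(_ _ e20) := cfw' p'.
  by move=> /d_nbhs[eta eta0 H]; exists eta => // q /H.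
have eta20 : 0 < eta / 2 by rewrite divr_gt0.
have [W pW WA] := d_ball p' eta20.
have Gp : G [set set_val q | q in [set q | exists2 q', d q q' < eta / 2 &
    e <= `|f (set_val q w) - f (set_val q' w)|]].
  by exists (eta / 2) => // q q' h h'; exists q => //; exists q'.
have [_ [[q [q' qq' big] <-] Wq]] := clp _ W Gp pW.
have pq := WA q Wq.
have h1 : d p' q < eta by rewrite (lt_trans pq)// gtr_pMr// invf_lt1// ltr1n.
have h2 : d p' q' < eta.
  by rewrite (le_lt_trans (d_tri _ q _))// [ltRHS](splitr eta) ltrD.
have := etaP _ h1; have := etaP _ h2 => k2 k1.
move: big; rewrite leNgt => /negP; apply.
rewrite -(subrKA (f (p w))) (le_lt_trans (ler_normD _ _))// [ltRHS](splitr e) ltrD//.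
by rewrite distrC.
Qed.

Let e_ (i : nat) : E' := SigSub (mem_set (@iter_env _ _ phi i)).

(** Up to a uniform error, the mean of [f] at [w] is a finite combination of class densities with
    coefficients depending on [f] and [w]; the densities do not, so one subsequence serves all [f]
    and [w]. *)
Lemma subsequence_of_metric : exists n : nat -> nat,
  [/\ increasing_seq n, forall k, (0 < n k)%N &
    forall (f : Omega -> R) w, continuous f -> exists c : R,
     (fun k => (n k)%:R^-1 * \sum_(i < n k) f (iter i phi w)) @ \oo --> c].
Proof.
have net m : exists ps : seq E', forall q, exists2 i, (i < size ps)%N &
    forall p0, d (nth p0 ps i) q < m.+1%:R^-1 by exact: finite_net.
have [ps psP] := choice net.
(* [cls (m, i)] is the index of a point of the [m]-th net close to [phi^i]. *)
have [cls clsP] := choice (fun mi : nat * nat =>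
  let: ex_intro2 j h1 h2 := psP mi.1 (e_ mi.2) in ex_intro (fun j => (j < size (ps mi.1))%N /\
    d (nth (e_ 0) (ps mi.1) j) (e_ mi.2) < mi.1.+1%:R^-1) j (conj h1 (h2 _))).
pose dens m j (n : nat) : R := n%:R^-1 * \sum_(i < n) (cls (m, i : nat) == j)%:R.
have dens_bnd m j : bnd (dens m j).
  exists 1 => n; rewrite ger0_norm ?mulr_ge0 ?invr_ge0 ?sumr_ge0//.
  case: n => [|n]; first by rewrite /dens invr0 mul0r.
  rewrite ler_pdivrMl ?ltr0Sn// mulr1.
  apply: (@le_trans _ _ (\sum_(i < n.+1) 1)); first by apply: ler_sum => i _; rewrite lern1 leq_b1.
  by rewrite sumr_const card_ord.
have [U [UU Uoo]] := @ultraFilterLemma nat \oo _.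
pose l m j := lim (dens m j @ U).
(* Past a given time, one index serves the finitely many classes of the first nets; iterating this
   is a diagonal extraction. *)
have step (kp : nat * nat) : exists n, (kp.2 < n)%N /\
    forall m, m \in iota 0 kp.1.+1 -> forall j, j \in iota 0 (size (ps m)) ->
      `|dens m j n - l m j| <= kp.1.+1%:R^-1.
  apply: (@filter_ex _ U); apply: filterI.
    by apply: Uoo; exists kp.2.+1.
  apply: near_all_in => m _; apply: near_all_in => j _.
  by apply: ulim_near => //.
have [nxt nxtP] := choice step.
pose n := fix n k := if k is k'.+1 then nxt (k, n k') else nxt (0%N, 0%N).
have nP k m j : (m <= k)%N -> (j < size (ps m))%N ->
    `|dens m j (n k) - l m j| <= k.+1%:R^-1.
  move=> mk jm; case: k mk => [|k] mk.
    by apply: (nxtP (0%N, 0%N)).2; rewrite mem_iota add0n.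
  by apply: (nxtP (k.+1, n k)).2; rewrite mem_iota add0n.
have n_inc k : (n k < n k.+1)%N by have [] := nxtP (k.+1, n k).
have n_pos k : (0 < n k)%N.
  by case: k => [|k]; [have [] := nxtP (0%N, 0%N)|exact: leq_ltn_trans (n_inc k)].
exists n; split => //; first by apply/increasing_seqP => k; rewrite ltEnat/=.
move=> f w cf.
pose F (q : E') := f (set_val q w).
pose u k := (n k)%:R^-1 * \sum_(i < n k) F (e_ i).
suff cu : cvgn u by exists (limn u).
apply/cauchy_cvgP/cauchy_exP => e e0.
have e20 : 0 < e / 2 by rewrite divr_gt0.
have [dl dl0 dlP] := eval_unif_continuous w cf e20.
pose m := Num.truncn dl^-1.
have mdl : m.+1%:R^-1 < dl by rewrite invf_plt ?posrE ?ltr0Sn// truncnS_gt.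
pose P j := nth (e_ 0) (ps m) j.
pose S := size (ps m).
exists (\sum_(j < S) F (P j) * l m j).
pose v k := \sum_(j < S) F (P j) * dens m j (n k).
(* Each [phi^i] is replaced by its net point, and the sum is regrouped by classes. *)
have uv k : `|v k - u k| <= e / 2.
  have -> : v k = (n k)%:R^-1 * \sum_(i < n k) F (P (cls (m, i : nat))).
    rewrite /v /dens; under eq_bigr do rewrite mulrCA mulr_sumr.
    rewrite -mulr_sumr exchange_big /=; congr (_ * _); apply: eq_bigr => i _.
    have [cS _] := clsP (m, i : nat).
    rewrite (bigD1 (Ordinal cS))//= eqxx mulr1 big1 ?addr0// => j jc.
    have -> : (cls (m, i : nat) == j) = false; last by rewrite mulr0.
    by apply/negbTE; apply: contra jc => /eqP h; apply/eqP/val_inj; rewrite /= h.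
  rewrite -mulrBr -sumrB normrM ger0_norm ?invr_ge0//.
  rewrite ler_pdivrMl ?ltr0n// (le_trans (ler_norm_sum _ _ _))//.
  apply: (@le_trans _ _ (\sum_(i < n k) (e / 2))).
    apply: ler_sum => i _; apply: ltW; apply: dlP.
    by have [_ h] := clsP (m, i : nat); apply: lt_trans mdl.
  by rewrite sumr_const card_ord mulr_natl.
have dens_cvg j : (j < S)%N -> (fun k => dens m j (n k)) @ \oo --> l m j.
  move=> jS; apply/cvgrPdist_lt => h h0.
  have /cvgrPdist_lt/(_ _ h0) := @cvg_harmonic R.
  apply: filterS2 (nbhs_infty_ge m) => k mk.
  rewrite sub0r normrN ger0_norm ?invr_ge0// => kh.
  by rewrite distrC (le_lt_trans (nP k m j mk jS)).
have v_cvg S' : (S' <= S)%N ->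
    (fun k => \sum_(j < S') F (P j) * dens m j (n k)) @ \oo --> \sum_(j < S') F (P j) * l m j.
  elim: S' => [_|S' IH S'S].
    by under eq_fun do rewrite big_ord0; rewrite big_ord0; exact: cvg_cst.
  under eq_fun do rewrite big_ord_recr; rewrite big_ord_recr /=.
  by apply: cvgD; [exact/IH/ltnW|apply: cvgMr; exact: dens_cvg].
have /cvgrPdist_lt/(_ _ e20) := v_cvg S (leqnn S); apply: filterS => k vk.
rewrite /ball /= -(subrKA (v k)) (le_lt_trans (ler_normD _ _))// [ltRHS](splitr e).
by rewrite ltr_leD.
Qed.

End Ordinary.

(** * Tameness forbids independent block means *)

Section Tame.
Context {R : realType} {Omega : metricType R} {s : scalar_kind}.
Hypothesis cO : compact [set: Omega].
Variable phi : continuousType Omega Omega.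

(** Independence would give times [iota] and a bound [c > 0] below the norms of all normalized
    combinations, while tameness makes their infimum 0. *)
Lemma tame_not_independent (x : Omega -> R) (mn : nat -> nat * nat) (a b : R) :
  tame phi s -> continuous x -> a < b ->
  ~ independent (fun k => block_mean (orbit_seq phi x) (mn k)) a b.
Proof.
move=> tam cx ab ind.
have [C xC] := bnd_continuous cO cx.
have [iota [c [c0 inc pos l1]]] := @independent_block_means_l1 R Omega
  (orbit_seq phi x) C mn a b (fun i t => xC _) ab ind.
have cX : continuous (of_real s \o x).
  by move=> t; apply: continuous_comp; [exact: cx|exact: continuous_of_real].
pose X : continuousType Omega (scalar_field R s) := mkcts cX.
have := tam X iota inc pos; set S := [set _ | _] => infS.
have hS : has_inf S.
  split; last by exists 0 => _ [N [al [_ ->]]]; exact: sup_norm_ge0.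
  exists (sup_norm (\sum_(k < 1) of_real s 1 *: iter (iota k) (koopman phi) X)).
  by exists 1%N, (fun=> 1); rewrite big_ord1 normr1.
have [r [N [al [al1 ->]]]] := inf_adherent c0 hS.
rewrite infS add0r ltNge => /negP; apply.
pose al' (i : nat) : R := if insub i is Some j then al j else 0.
have al'E (i : 'I_N) : al' i = al i by rewrite /al' valK.
have <- : c * \sum_(i < N) `|al' i| = c.
  by under eq_bigr do rewrite al'E; rewrite al1 mulr1.
apply: l1 => t.
have := sup_norm_ub (\sum_(k < N) of_real s (al k) *: iter (iota k) (koopman phi) X) t cO.
apply: le_trans; rewrite cts_sumE.
rewrite (_ : \sum_i _ = of_real s (\sum_(i < N) al' i * orbit_seq phi x (iota i) t)).
  by rewrite modulus_of_real.
rewrite of_real_sum; apply: eq_bigr => i _; rewrite al'E of_realM.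
have -> : (of_real s (al i) *: iter (iota i) (koopman phi) X) t =
  of_real s (al i) * (iter (iota i) (koopman phi) X) t by [].
by rewrite iter_koopmanE.
Qed.

End Tame.

Theorem proposition3p9 (R : realType) (s : scalar_kind) (Omega : metricType R)
    (cO : compact [set: Omega]) (phi : continuousType Omega Omega) :
  (ordinary phi ->
     exists n : nat -> nat,
       [/\ increasing_seq n,
           forall k, (0 < n k)%N &
           WstarO_convergent (fun k => cesaro_mean (s := s) cO phi (n k))]) /\
  (tame phi s -> Equivalence (proximal phi) ->
     WstarO_convergent (fun n => cesaro_mean (s := s) cO phi n)).
Proof.
split=> [[d [_ _ d_tri d_nbhs]]|tam prox_eqv].
  have [n [n_inc n_pos n_cvg]] := subsequence_of_metric cO d_tri d_nbhs.
  by exists n; split => //; apply: WstarO_convergent_of_real.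
apply: (WstarO_convergent_of_real cO (n := id)) => x w cx.
have [c xc] := birkhoff_cvg cO cx
  (fun mn a b ab => tame_not_independent cO tam cx ab) prox_eqv w.
(* [birkhoff_cvg] averages [n.+1] terms, hence the shift of the index. *)
by exists c; rewrite -cvg_shiftS.
Qed.
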